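(* Let $m\in\mathbb{N}$, $m\ge 1$. For every integer $\ell$ with $1\le \ell\le m$, $$\tilde{\psi}_\ell^{(m+1)}(x)=\sqrt{\frac{m+1}{m+1-\ell}}\left(\frac{2x+m+1}{2m}\,\tilde{\psi}_{\ell}^{(m)}\!\left(x+\tfrac12\right)+\frac{m+1-2x}{2m}\,\tilde{\psi}_{\ell}^{(m)}\!\left(x-\tfrac12\right)+\frac{\ell}{m}\,\tilde{\psi}_{\ell}^{(m)}(x)\right),$$ and moreover $$\tilde{\psi}_{m+1}^{(m+1)}(x)=\frac{2x+m+1}{2m}\,\tilde{\psi}_m^{(m)}\!\left(x+\tfrac12\right)+\frac{2x-m-1}{2m}\,\tilde{\psi}_m^{(m)}\!\left(x-\tfrac12\right)-\frac{2x}{m}\,\tilde{\psi}_m^{(m)}(x).$$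
   Context: The Fourier transform is $\hat f(\omega)=\int_{-\infty}^{\infty} f(x)e^{-i\omega x}\,dx$. For integers $1\le\ell\le m$, the (centered) B-spline framelet $\tilde\psi_\ell^{(m)}\in L_2(\mathbb{R})$ is the function with Fourier transform $$\widehat{\tilde{\psi}}_\ell^{(m)}(\omega)= i^\ell \sqrt{\binom{m}{\ell}}\;\frac{\cos^{m-\ell}(\omega/4)\,\sin^{m+\ell}(\omega/4)}{(\omega/4)^m}.$$ These functions are defined through their Fourier transforms as elements of $L_2(\mathbb{R})$; identities between them are understood for almost every $x\in\mathbb{R}$. *)

(* Defs.v *)
From HB Require Import structures.
From mathcomp Require Import all_boot all_order all_algebra.
From mathcomp Require Import all_classical all_reals all_analysis.
From mathcomp Require Import complex.

Set Implicit Arguments.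
Unset Strict Implicit.
Unset Printing Implicit Defensive.

Import Order.TTheory GRing.Theory Num.Theory.
Import numFieldNormedType.Exports.

Local Open Scope classical_set_scope.
Local Open Scope ring_scope.
Local Open Scope complex_scope.

Section L2Fourier.
Context {R : realType}.
Implicit Types f F : R -> R[i].

Definition L2 f : Prop :=
  ((fun x => complex.Re (f x)) \in Lfun (@lebesgue_measure R) 2%:E) /\
  ((fun x => complex.Im (f x)) \in Lfun (@lebesgue_measure R) 2%:E).

Definition L2norm f : \bar R :=
  Lnorm (@lebesgue_measure R) 2%:E (fun x => (Normc.normc (f x))%:E).

Definition cintegral (D : set R) f : R[i] :=
  (\int[@lebesgue_measure R]_(x in D) complex.Re (f x))
  +i* (\int[@lebesgue_measure R]_(x in D) complex.Im (f x)).

(* e^{it} for real t *)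
Definition cis (t : R) : R[i] := cos t +i* sin t.

Definition truncated_fourier f (n : nat) (w : R) : R[i] :=
  cintegral `[- n%:R, n%:R] (fun x => f x * cis (- (w * x))).

(* Plancherel's extension of the Fourier transform to L2: an L2 function need
   not be integrable on R, so the integral of f(x) e^{-iwx} is taken as the
   limit in L2 norm, as n grows, of the integrals over [-n, n].  F is
   determined by f up to a null set. *)
Definition is_fourier_transform f F : Prop :=
  [/\ L2 f, L2 F &
   L2norm (fun w => truncated_fourier f n w - F w) @[n --> \oo] --> 0%E].

(* At w = 0 division by zero gives the value 0 (when m > 0), which is also the
   limit of the quotient there when l > 0. *)
Definition framelet_hat (m l : nat) (w : R) : R[i] :=
  (0 +i* 1) ^+ l *
  (Num.sqrt ('C(m, l)%:R) *
   (cos (w / 4) ^+ (m - l) * sin (w / 4) ^+ (m + l) / (w / 4) ^+ m))%:C.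

(* f represents the centered B-spline framelet of indices (m, l), 1 <= l <= m,
   an element of L2 and hence only defined up to a null set. *)
Definition is_framelet (m l : nat) f : Prop :=
  is_fourier_transform f (framelet_hat m l).

End L2Fourier.

(* Main.v *)
Require Import Defs.
From mathcomp Require Import all_boot all_order all_algebra.
From mathcomp Require Import all_classical all_reals all_analysis.
From mathcomp Require Import measurable_realfun complex ring lra.

(* Both sides of each identity are determined by their Fourier transforms, so
   it is enough to find, for all 1 <= l <= m, a bounded compactly supported
   real function whose Fourier integral is framelet_hat m l at every point.
   The recursions of the theorem themselves produce it from the Haar function
   (m = l = 1): multiplication by x is differentiation on the Fourier side,
   and G = framelet_hat m l satisfies, with t = w / 4,
     4 t sin t cos t G' = (t ((m + l) cos^2 t - (m - l) sin^2 t)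
                           - m sin t cos t) G.
   Uniqueness of the L2 Fourier transform: if the truncated transforms of d
   tend to 0 in L2, pairing them with e^(-y|w|) e^(iaw) shows that all Poisson
   integrals of d vanish; integrating these over a in an interval and letting
   y tend to 0 gives that d has integral 0 on every interval. *)

Set Implicit Arguments.
Unset Strict Implicit.
Unset Printing Implicit Defensive.

Import Order.TTheory GRing.Theory Num.Theory.
Import numFieldNormedType.Exports.

Local Open Scope classical_set_scope.
Local Open Scope ring_scope.

(** * Invariance of Lebesgue measure *)

Section Invariance.
Context {R : realType}.
Local Notation mu := (@lebesgue_measure R).

(** The coefficients of both recursions are this differential equation in disguise. Since (m + l)
    cos^2 t - (m - l) sin^2 t = m cos(w/2) + l and 2 sin t cos t = sin(w/2), solving it for the term
    m sin t cos t G gives (sin t cos t / t) G = cos(w/2) G + (l/m) G - (2/m) sin(w/2) G'. The left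
    side is, up to a constant, the transform of indices (m+1, l). On the right, the factors cos(w/2)
    and sin(w/2) are sums and differences of shifts by 1/2, and G' is the transform of -i x g(x).
    Multiplication by x may lead out of L2, so the right-hand sides are not transformed directly:
    each framelet is first replaced, almost everywhere, by a compactly supported g, whose Fourier
    integrals converge absolutely and can be differentiated in w. Uniqueness accordingly compares an
    L2 function with a g whose truncated transforms are eventually exact. *)

Lemma measurable_shift (c : R) :
  measurable_fun [set: measurableTypeR R] ((+%R^~ c) : _ -> measurableTypeR R).
Proof. exact: measurable_funD. Qed.

Lemma lebesgue_measure_shift (c : R) (A : set R) : measurable A ->
  pushforward mu ((+%R^~ c) : _ -> measurableTypeR R) A = mu A.
Proof.
move=> mA; apply/esym/lebesgue_measure_unique => //=; first exact: measurable_shift.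
move=> _ _ [[a b] /= _ <-].
have E : +%R^~ c @^-1` `]a, b] = `](a - c), (b - c)]%classic.
  by apply/seteqP; split => x /=; rewrite !in_itv/= ltrBlDr lerBrDr.
rewrite /pushforward E !lebesgue_measure_itv/= !lte_fin ltrD2r.
by case: ifP => // _; rewrite -!EFinB; congr EFin; ring.
Qed.

Lemma integrable_shift (c : R) (f : R -> R) :
  mu.-integrable setT (EFin \o f) ->
  mu.-integrable setT (EFin \o (fun x => f (x + c))).
Proof.
move=> /integrableP[mf foo]; apply/integrableP; split.
  by apply: (measurableT_comp mf); exact: measurable_shift.
suff <- : (\int[mu]_x `|(EFin \o f) x| = \int[mu]_x `|(f (x + c))%:E|)%E by [].
under eq_integral do rewrite /=.
transitivity (\int[pushforward mu ((+%R^~ c) : _ -> measurableTypeR R)]_x `|(f x)%:E|)%E.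
  apply: eq_measure_integral => [|? A mA _]; first exact: measurable_shift.
  exact/esym/lebesgue_measure_shift.
rewrite ge0_integral_pushforward//; last exact: measurableT_comp.
exact: measurable_shift.
Qed.

Lemma Rintegral_shift (c : R) (f : R -> R) :
  mu.-integrable setT (EFin \o f) ->
  \int[mu]_x f (x + c) = \int[mu]_x f x.
Proof.
move=> intf; congr fine.
transitivity (\int[pushforward mu ((+%R^~ c) : _ -> measurableTypeR R)]_x (EFin \o f) x)%E.
  rewrite (@integral_pushforward _ _ _ _ _ _ (measurable_shift c) mu setT (EFin \o f))//.
  - exact: measurable_int intf.
  - exact: (integrable_shift c intf).
apply: eq_measure_integral => [|? A mA _]; first exact: measurable_shift.
exact: lebesgue_measure_shift.
Qed.

(** Used at the very end: the recursions evaluate a function known only almost everywhere at x + 1/2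
    and x - 1/2, so its exceptional null set has to be translated. *)
Lemma ae_shift (c : R) (P : R -> Prop) :
  {ae mu, forall x, P x} -> {ae mu, forall x, P (x + c)}.
Proof.
move=> [N [mN N0 PN]]; exists (+%R^~ c @^-1` N); split.
- by rewrite -[X in measurable X]setTI; apply: measurable_shift.
- by rewrite -[LHS](lebesgue_measure_shift c mN) in N0.
- by move=> x /= nP; exact: PN.
Qed.

Lemma Rintegral_odd (f : R -> R) : mu.-integrable setT (EFin \o f) ->
  (forall x, f (- x) = - f x) -> \int[mu]_x f x = 0.
Proof.
move=> intf odd.
have mf := measurable_int mu intf.
have E : \int[mu]_x f x = \int[mu]_x (- f x).
  congr fine.
  transitivity (\int[pushforward mu (-%R : _ -> measurableTypeR R)]_x (EFin \o f) x)%E.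
    by apply: eq_measure_integral => //= A mA _; exact/esym/lebesgue_measureN.
  have mN : measurable_fun [set: measurableTypeR R] (-%R : _ -> measurableTypeR R).
    exact: oppr_measurable.
  rewrite (@integral_pushforward _ _ _ _ _ _ mN mu setT (EFin \o f))//.
  - by apply: eq_integral => x _ /=; rewrite odd.
  - have := integrableN intf; apply: eq_integrable => //= x _ /=.
    by rewrite odd.
move: E; under [RHS]eq_Rintegral do rewrite -mulN1r.
rewrite RintegralZl// mulN1r; lra.
Qed.

End Invariance.

(** * Fubini for bounded kernels *)

Section IntegrableReal.
Context d {T : measurableType d} {R : realType} (mu : {measure set T -> \bar R}).
Variables (D : set T) (mD : measurable D).
Implicit Types f g : T -> R.

Lemma integrable_mull (r : R) f : mu.-integrable D (EFin \o f) ->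
  mu.-integrable D (EFin \o (fun x => r * f x)).
Proof. by move=> /(integrableZl mD r); apply: eq_integrable. Qed.

Lemma integrable_add f g :
  mu.-integrable D (EFin \o f) -> mu.-integrable D (EFin \o g) ->
  mu.-integrable D (EFin \o (fun x => f x + g x)).
Proof. by move=> intf /(integrableD mD intf); apply: eq_integrable. Qed.

Lemma integrable_sub f g :
  mu.-integrable D (EFin \o f) -> mu.-integrable D (EFin \o g) ->
  mu.-integrable D (EFin \o (fun x => f x - g x)).
Proof. by move=> intf /(integrableB mD intf); apply: eq_integrable. Qed.

End IntegrableReal.

Section KernelFubini.
Context {R : realType}.
Local Notation mu := (@lebesgue_measure R).

Lemma integrable_bounded_mul (f c : R -> R) (M : R) :
  mu.-integrable setT (EFin \o f) -> measurable_fun setT c ->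
  (forall x, `|c x| <= M) ->
  mu.-integrable setT (EFin \o (fun x => f x * c x)).
Proof.
move=> intf mc cM.
have mf : measurable_fun setT f by apply/measurable_EFinP; exact: measurable_int intf.
apply: (@le_integrable _ _ _ mu setT measurableT _ (EFin \o (fun x => M * f x))).
- by apply/measurable_EFinP; exact: measurable_funM.
- move=> x _ /=; rewrite lee_fin !normrM mulrC ler_wpM2r//.
  by rewrite (le_trans (cM x))// ler_norm.
- have := integrableZl measurableT M intf.
  by apply: eq_integrable => // x _ /=; rewrite EFinM.
Qed.

Variables (u v : R -> R) (c : R * R -> R) (M : R).
Hypotheses (intu : mu.-integrable setT (EFin \o u))
           (intv : mu.-integrable setT (EFin \o v)).
Hypotheses (mc : measurable_fun setT c) (cM : forall z, `|c z| <= M).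

Let mu1 : measurable_fun setT u.
Proof. by apply/measurable_EFinP; exact: measurable_int intu. Qed.
Let mv : measurable_fun setT v.
Proof. by apply/measurable_EFinP; exact: measurable_int intv. Qed.
Let mc1 w : measurable_fun setT (fun x => c (w, x)).
Proof. exact: (measurableT_comp mc). Qed.
Let mc2 x : measurable_fun setT (fun w => c (w, x)).
Proof. exact: (measurableT_comp mc). Qed.

Let F (z : R * R) := u z.1 * v z.2 * c z.

Let mF : measurable_fun setT F.
Proof.
apply: measurable_funM => //; apply: measurable_funM.
- exact: measurableT_comp.
- exact: measurableT_comp.
Qed.

Let F1 w : (\int[mu]_x (EFin \o F) (w, x))%E = (u w * \int[mu]_x (v x * c (w, x)))%:E.
Proof.
under eq_integral do rewrite /F /= -mulrA EFinM.
have intvc := integrable_bounded_mul intv (mc1 w) (fun x => cM (w, x)).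
by rewrite integralZl// EFinM fineK//; exact: integrable_fin_num.
Qed.

Let F2 x : (\int[mu]_w (EFin \o F) (w, x))%E = (v x * \int[mu]_w (u w * c (w, x)))%:E.
Proof.
under eq_integral do rewrite /F /= [u _ * _]mulrC -mulrA EFinM.
have intuc := integrable_bounded_mul intu (mc2 x) (fun w => cM (w, x)).
by rewrite integralZl// EFinM fineK//; exact: integrable_fin_num.
Qed.

(** In absolute value [c] is replaced by its bound [M], which leaves [M] times a product of two
    integrable functions of separate variables; the Tonelli criterion then applies. *)
Let intF : (mu \x mu)%E.-integrable setT (EFin \o F).
Proof.
apply/(integrable12ltyP mu mu); first exact/measurable_EFinP.
have M0 : 0 <= M by rewrite (le_trans _ (cM (0, 0))).
set I := (\int[mu]_x `|(v x)%:E|)%E.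
have Ioo : (I < +oo)%E by have /integrableP[] := intv.
have Ifin : I \is a fin_num by rewrite ge0_fin_numE// integral_ge0.
have /integrableP[_ Uoo] := intu.
apply: (@le_lt_trans _ _ (\int[mu]_x ((M * fine I)%:E * `|(u x)%:E|))%E).
  apply: ge0_le_integral => //.
  - by move=> x _; exact: integral_ge0.
  - apply: (@measurable_fun_fubini_tonelli_F _ _ _ _ _ mu (abse \o EFin \o F)) => //=.
    by apply: measurableT_comp => //; exact/measurable_EFinP.
  - apply: emeasurable_funM => //.
    by apply: measurableT_comp => //; exact/measurable_EFinP.
  - move=> x _.
    rewrite (_ : (_ * _)%E = (\int[mu]_y ((M * `|u x|)%:E * `|(v y)%:E|))%E); last first.
      rewrite ge0_integralZl//; last 2 first.
      + by apply: measurableT_comp => //; exact/measurable_EFinP.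
      + by rewrite lee_fin mulr_ge0.
      by rewrite -/I -(fineK Ifin) /= -!EFinM mulrAC.
    apply: ge0_le_integral => //.
    + apply: measurableT_comp => //; apply/measurable_EFinP.
      exact: (measurableT_comp mF).
    + apply: emeasurable_funM => //.
      by apply: measurableT_comp => //; exact/measurable_EFinP.
    + move=> y _; rewrite /F /= lee_fin !normrM mulrC mulrA ler_wpM2r// ler_wpM2r//.
rewrite ge0_integralZl//; last 2 first.
- by apply: measurableT_comp => //; exact/measurable_EFinP.
- by rewrite lee_fin mulr_ge0// fine_ge0// integral_ge0.
by rewrite lte_mul_pinfty// lee_fin mulr_ge0// fine_ge0// integral_ge0.
Qed.

Lemma kernel_Fubini :
  \int[mu]_w (u w * \int[mu]_x (v x * c (w, x))) =
  \int[mu]_x (v x * \int[mu]_w (u w * c (w, x))).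
Proof.
have := Fubini intF.
under eq_integral do rewrite F1.
under [in RHS]eq_integral do rewrite F2.
by move=> /(congr1 fine).
Qed.

Lemma measurable_kernel :
  measurable_fun setT (fun w => u w * \int[mu]_x (v x * c (w, x))).
Proof.
apply/measurable_EFinP; have := measurable_fubini_F intF.
by rewrite /fubini_F; apply: eq_measurable_fun => w _; rewrite F1.
Qed.

End KernelFubini.

(** * The Poisson kernel *)

Section AbelKernel.
Context {R : realType}.
Local Notation mu := (@lebesgue_measure R).
Variable y : R.
Hypothesis y0 : 0 < y.

(** The damping factor of Abel summation. Its Fourier transform is twice the Poisson kernel, and its
    square belongs to the same family, so it is both integrable and square integrable. *)
Definition abel (w : R) : R := expR (- (y * `|w|)).

(** An antiderivative of e^(-yw) (1 + cos(uw)), found from the real part of e^((-y+iu)w). It tends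
    to 0 at infinity, so only its value at 0 enters the integral. *)
Let primitive (u w : R) : R :=
  expR (- (y * w)) * ((u * sin (u * w) - y * cos (u * w)) / (y ^+ 2 + u ^+ 2) - y^-1).

Let den_gt0 (u : R) : 0 < y ^+ 2 + u ^+ 2.
Proof. by rewrite ltr_pwDl ?exprn_gt0 ?sqr_ge0. Qed.

Let is_derive_primitive (u w : R) :
  is_derive w 1 (primitive u) (expR (- (y * w)) * (1 + cos (u * w))).
Proof.
rewrite /primitive.
apply: is_derive_eq; rewrite !scaler0 !scaler1 /GRing.scale/=.
have := lt0r_neq0 (den_gt0 u); have := lt0r_neq0 y0.
move=> /= y1 d1.
by field; rewrite y1.
Qed.

Let continuous_primitive (u : R) : continuous (primitive u).
Proof.
move=> w; apply/differentiable_continuous/derivable1_diffP.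
exact: (@ex_derive _ _ _ _ _ _ _ (is_derive_primitive u w)).
Qed.

Let continuous_integrand (u : R) : continuous (fun w => abel w * (1 + cos (u * w))).
Proof.
move=> w; apply: continuousM.
  apply: (@continuous_comp _ _ _ (fun w => - (y * `|w|)) expR).
    apply: continuousN; apply: continuousM; first exact: cvg_cst.
    exact: norm_continuous.
  exact: continuous_expR.
apply: continuousD; first exact: cvg_cst.
apply: (@continuous_comp _ _ _ (fun w => u * w) cos); last exact: continuous_cos.
exact: mulrl_continuous.
Qed.

Let continuous_halfline_integrand (u : R) :
  continuous (fun w : R => expR (- (y * w)) * (1 + cos (u * w))).
Proof.
move=> w; apply: (@continuousM R R (fun w : R => expR (- (y*w))) (fun w => 1 + cos (u*w))).
  apply: (@continuous_comp _ _ _ (fun w => - (y * w)) expR); last exact: continuous_expR.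
  by apply: continuousN; exact: mulrl_continuous.
apply: continuousD; first exact: cvg_cst.
apply: (@continuous_comp _ _ _ (fun w => u * w) cos); last exact: continuous_cos.
exact: mulrl_continuous.
Qed.

Let primitive_cvgy (u : R) : primitive u w @[w --> +oo] --> 0.
Proof.
apply/cvgr0Pnorm_le => e e0.
(* [K] bounds the non-exponential factor for all [w]; then e^(yw) >= 1 + yw makes e^(-yw) K at most
   [e] as soon as yw >= K / e. *)
pose K := (`|u| + y) / (y ^+ 2 + u ^+ 2) + y^-1.
have K0 : 0 < K.
  rewrite ltr_wpDl ?invr_gt0// divr_ge0 ?(ltW (den_gt0 u))//.
  by rewrite addr_ge0// ltW.
near=> w.
have w0 : 0 < w by near: w; exact: nbhs_pinfty_gt.
apply: (@le_trans _ _ (expR (- (y * w)) * K)).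
  rewrite /primitive normrM (ger0_norm (expR_ge0 _)) ler_wpM2l ?expR_ge0//.
  rewrite (le_trans (ler_normB _ _))// lerD//; last by rewrite gtr0_norm ?invr_gt0.
  rewrite normrM [X in _ * X]gtr0_norm ?invr_gt0// ler_wpM2r ?invr_ge0 ?(ltW (den_gt0 u))//.
  rewrite (le_trans (ler_normB _ _))// lerD// normrM.
    by rewrite ler_piMr// ler_norml sin_geN1 sin_le1.
  by rewrite (gtr0_norm y0) ler_piMr ?(ltW y0)// ler_norml cos_geN1 cos_le1.
rewrite expRN mulrC ler_pdivrMr ?expR_gt0// mulrC -ler_pdivrMr//.
apply: le_trans (expR_ge1Dx _).
apply: (@le_trans _ _ (y * w)); last by rewrite lerDr.
rewrite -(ler_pdivrMl _ _ y0).
near: w; apply: nbhs_pinfty_ge; exact: num_real.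
Unshelve. all: by end_near. Qed.

(* The summand 1 keeps the integrand nonnegative, as needed to apply the
   fundamental theorem of calculus on an unbounded interval. *)
Let integral_abel_1Dcos (u : R) :
  (\int[mu]_w (abel w * (1 + cos (u * w)))%:E)%E =
  (2 * (y^-1 + y / (y ^+ 2 + u ^+ 2)))%:E.
Proof.
have ge0 w : 0 <= abel w * (1 + cos (u * w)).
  by rewrite mulr_ge0 ?expR_ge0// -lerBlDl sub0r cos_geN1.
rewrite ge0_symfun_integralT//; last first.
  by move=> w /=; rewrite /abel normrN mulrN cosN.
rewrite -set_itvcy EFinM; congr *%E.
transitivity (\int[mu]_(w in `[0%R, +oo[) (expR (- (y * w)) * (1 + cos (u * w)))%:E)%E.
  apply: eq_integral => w; rewrite inE/= in_itv/= andbT => w0.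
  by rewrite /abel ger0_norm.
rewrite (@ge0_continuous_FTC2y _ _ (primitive u) _ 0).
- rewrite /primitive !mulr0 sin0 cos0 oppr0 expR0 mul1r -EFinB; congr EFin.
  by rewrite sub0r mulr1 mulr0 sub0r mulNr; ring.
- by move=> w w0; have := ge0 w; rewrite /abel ger0_norm.
- exact/continuous_subspaceT/continuous_halfline_integrand.
- exact: primitive_cvgy.
- by move=> w _; exact: (@ex_derive _ _ _ _ _ _ _ (is_derive_primitive u w)).
- by apply: cvg_at_right_filter; exact: continuous_primitive.
- by move=> w _; rewrite derive1E (@derive_val _ _ _ _ _ _ _ (is_derive_primitive u w)).
Qed.

Let integrable_abel_1Dcos (u : R) :
  mu.-integrable setT (EFin \o (fun w => abel w * (1 + cos (u * w)))).
Proof.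
apply/integrableP; split.
  by apply/measurable_EFinP; exact: continuous_measurable_fun.
under eq_integral => w _.
  rewrite /= ger0_norm; last first.
    by rewrite mulr_ge0 ?expR_ge0// -lerBlDl sub0r cos_geN1.
  over.
by rewrite integral_abel_1Dcos ltry.
Qed.

Lemma measurable_abel : measurable_fun setT abel.
Proof.
apply: measurableT_comp => //; apply: measurableT_comp => //.
exact: measurable_funM.
Qed.

Lemma integrable_abel : mu.-integrable setT (EFin \o abel).
Proof.
(* At u = 0 the integrand with the summand 1 is twice [abel]. *)
apply: (le_integrable measurableT _ _ (integrable_abel_1Dcos 0)).
  by apply/measurable_EFinP; exact: measurable_abel.
move=> w _; rewrite /= mul0r cos0 lee_fin normrM ler_peMr// ger0_norm//; lra.
Qed.

Lemma Rintegral_abel_cos (u : R) :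
  \int[mu]_w (abel w * cos (u * w)) = 2 * y / (y ^+ 2 + u ^+ 2).
Proof.
have E v : \int[mu]_w (abel w * (1 + cos (v * w))) = 2 * (y^-1 + y / (y ^+ 2 + v ^+ 2)).
  by rewrite /Rintegral integral_abel_1Dcos.
have E0 : \int[mu]_w abel w = 2 * y^-1.
  transitivity (\int[mu]_w (2^-1 * (abel w * (1 + cos (0 * w))))).
    by apply: eq_Rintegral => w _; rewrite mul0r cos0; field.
  rewrite RintegralZl// E expr0n addr0; field.
  exact: lt0r_neq0.
transitivity (\int[mu]_w (abel w * (1 + cos (u * w)) - abel w)).
  by apply: eq_Rintegral => w _; ring.
rewrite RintegralB// ?E ?E0//; last exact: integrable_abel.
by field; rewrite (lt0r_neq0 (den_gt0 u)) (lt0r_neq0 y0).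
Qed.

Lemma abelN w : abel (- w) = abel w.
Proof. by rewrite /abel normrN. Qed.

End AbelKernel.

Lemma abel_sqr {R : realType} (y w : R) : abel y w ^+ 2 = abel (2 * y) w.
Proof. by rewrite /abel expr2 -expRD; congr expR; ring. Qed.

(** [n.+1%:R^-1] is the height y of the Poisson kernel going to 0. At t = 0 the sequence is
    constantly 0, which agrees with [Num.sg 0 = 0], so convergence holds at every point. *)
Lemma cvg_atan_dilation {R : realType} (t : R) :
  atan (t / n.+1%:R^-1) @[n --> \oo] --> Num.sg t * (pi / 2).
Proof.
have pos (s : R) : 0 < s -> atan (s / n.+1%:R^-1) @[n --> \oo] --> pi / 2.
  move=> s0.
  have sy : s / n.+1%:R^-1 @[n --> \oo] --> +oo.
    apply/cvgryPge => A; near=> n.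
    rewrite invrK -ler_pdivrMl// (@le_trans _ _ n%:R) ?ler_nat//.
    by near: n; exact: nbhs_infty_ger.
  by have := cvg_comp _ atan sy (@cvgy_atan R); exact.
have [t0|t0|->] := ltgtP t 0.
- rewrite ltr0_sg// mulN1r.
  have tN : 0 < - t by rewrite oppr_gt0.
  rewrite (_ : (fun _ => _) = - (fun n : nat => atan (- t / n.+1%:R^-1))).
    by apply: cvgN; exact: pos.
  by apply/funext => n; rewrite opprfctE mulNr atanN opprK.
- by rewrite gtr0_sg// mul1r; exact: pos.
- by rewrite sgr0 mul0r; under eq_fun do rewrite mul0r atan0; exact: cvg_cst.
Unshelve. all: by end_near. Qed.

(** The Poisson kernel of the upper half-plane without its usual factor 1/pi: its total mass is
    pi. *)
Definition poisson {R : realType} (y a x : R) : R := y / (y ^+ 2 + (x - a) ^+ 2).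

Section Poisson.
Context {R : realType}.
Implicit Types (y a x A : R).

Lemma poisson_den_gt0 y a x : 0 < y -> 0 < y ^+ 2 + (x - a) ^+ 2.
Proof. by move=> y0; rewrite ltr_pwDl ?exprn_gt0 ?sqr_ge0. Qed.

Lemma poisson_ge0 y a x : 0 < y -> 0 <= poisson y a x.
Proof. by move=> y0; rewrite divr_ge0 ?(ltW y0) ?(ltW (poisson_den_gt0 _ _ y0)). Qed.

Lemma poissonC y a x : poisson y a x = poisson y x a.
Proof. by rewrite /poisson -[(x - a) ^+ 2]sqrrN opprB. Qed.

Lemma continuous_poisson y x : 0 < y -> continuous ((@poisson R y) ^~ x).
Proof.
move=> y0 a; apply: (@continuousM R R (fun=> y) (fun a => (y ^+ 2 + (x - a) ^+ 2)^-1)).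
  exact: cvg_cst.
apply: (@continuousV R R (fun a => y ^+ 2 + (x - a) ^+ 2)).
  exact/lt0r_neq0/poisson_den_gt0.
apply: continuousD; first exact: cvg_cst.
apply: (@continuous_comp _ _ _ (fun a => x - a) (fun z => z ^+ 2)).
  by apply: continuousB; [exact: cvg_cst | exact: cvg_id].
exact: exprn_continuous.
Qed.

Lemma measurable_poisson y a : 0 < y -> measurable_fun setT (@poisson R y a).
Proof.
move=> y0; rewrite (_ : poisson y a = (@poisson R y) ^~ a).
  by apply: continuous_measurable_fun; exact: continuous_poisson.
by apply/funext => x; exact: poissonC.
Qed.

(** The denominator of the kernel absorbs the growth of the weight, since y^2 + (x - a)^2 times the
    kernel is [y]. Keeping [poisson] itself on the right, rather than its maximum 1/y, allows
    integration over [a] to give a bound that does not blow up as y tends to 0. *)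
Lemma poisson_weight_le y a x A : 0 < y -> `|a| <= A ->
  (1 + x ^+ 2) * poisson y a x <= (1 + 2 * A ^+ 2) * poisson y a x + 2 * y.
Proof.
move=> y0 aA.
have a2A2 : a ^+ 2 <= A ^+ 2.
  by rewrite -[leLHS]real_normK ?num_real// lerXn2r ?nnegrE// (le_trans _ aA).
have -> : (1 + 2 * A ^+ 2) * poisson y a x + 2 * y =
    (1 + 2 * A ^+ 2 + 2 * (y ^+ 2 + (x - a) ^+ 2)) * poisson y a x.
  by rewrite /poisson; field; exact/lt0r_neq0/poisson_den_gt0.
rewrite ler_wpM2r ?poisson_ge0//.
(* x^2 <= 2 a^2 + 2 (x - a)^2 *)
have := sqr_ge0 (x - 2 * a); have := sqr_ge0 y; nra.
Qed.

Lemma norm_poisson_weight_le y a x A : 0 < y -> `|a| <= A ->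
  `|(1 + x ^+ 2) * poisson y a x| <= (1 + 2 * A ^+ 2) / y + 2 * y.
Proof.
move=> y0 aA; rewrite ger0_norm; last first.
  by rewrite mulr_ge0 ?poisson_ge0// addr_ge0 ?sqr_ge0.
rewrite (le_trans (poisson_weight_le x y0 aA))// lerD2r ler_wpM2l//.
  by rewrite addr_ge0// mulr_ge0// sqr_ge0.
rewrite /poisson ler_pdivrMr ?poisson_den_gt0// mulrDr expr2 mulKf ?gt_eqF// lerDl.
by rewrite mulr_ge0 ?sqr_ge0// invr_ge0 ltW.
Qed.

End Poisson.

(** * Functions all of whose Poisson integrals vanish *)

Section PoissonVanish.
Context {R : realType}.
Local Notation mu := (@lebesgue_measure R).
Local Notation q := (fun x : R => 1 + x ^+ 2).

Let q_gt0 (x : R) : 0 < q x.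
Proof. by rewrite ltr_pwDl// sqr_ge0. Qed.

Variable f : R -> R.
Hypothesis intf : mu.-integrable setT (EFin \o (fun x => f x / q x)).

Let mf : measurable_fun setT f.
Proof.
have mh : measurable_fun setT (fun x => f x / q x).
  by apply/measurable_EFinP; exact: measurable_int intf.
apply: (eq_measurable_fun (fun x => f x / q x * q x)).
  by move=> x _; rewrite mulfVK ?gt_eqF.
by apply: measurable_funM => //; apply: measurable_funD => //; exact: measurable_funX.
Qed.

Lemma integrable_weighted_mul (c : R -> R) (M : R) : measurable_fun setT c ->
  (forall x, `|q x * c x| <= M) ->
  mu.-integrable setT (EFin \o (fun x => f x * c x)).
Proof.
move=> mc cM.
have := @integrable_bounded_mul _ _ (fun x => q x * c x) M intf.
move=> /(_ _ cM) H; apply: eq_integrable (H _) => //.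
  by move=> x _ /=; rewrite mulrA mulfVK ?gt_eqF.
by apply: measurable_funM => //; apply: measurable_funD => //; exact: measurable_funX.
Qed.

Lemma integrable_weighted_bounded (a b : R) :
  mu.-integrable `[a, b] (EFin \o f).
Proof.
apply/integrable_mkcond => //; rewrite (_ : _ \_ _ = EFin \o (fun x => f x * \1_`[a, b] x)).
  apply: (@integrable_weighted_mul _ (1 + (`|a| + `|b|) ^+ 2)).
    exact: measurable_indic.
  move=> x; rewrite indicE.
  have [/set_mem|_] := boolP (x \in `[a, b]%classic); rewrite ?mulr1 ?mulr0.
    rewrite /= in_itv/= => /andP[ax xb]; rewrite gtr0_norm// lerD2l.
    rewrite -[leLHS]real_normK ?num_real// lerXn2r ?nnegrE ?addr_ge0//.
    have := ler_norm b; have := ler_norm (- a); rewrite normrN ler_norml.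
    by have := normr_ge0 a; have := normr_ge0 b; move=> *; apply/andP; split; lra.
  by rewrite normr0 addr_ge0// exprn_ge0 ?addr_ge0.
apply/funext => x; rewrite /= patchE indicE; by case: (x \in _); rewrite ?mulr1 ?mulr0.
Qed.

(** Lebesgue differentiation: the indefinite integral of f starting at -n is identically 0, while
    its derivative is f almost everywhere to the right of -n. Countably many n cover the line. *)
Lemma Rintegral_intervals_eq0_ae :
  (forall a b : R, a < b -> \int[mu]_(x in `[a, b]) f x = 0) ->
  {ae mu, forall x, f x = 0}.
Proof.
move=> f0.
have locf : locally_integrable setT f.
  split => //; first exact: openT.
  move=> K _ cK.
  have [M [Mreal KM]] := compact_bounded cK.
  have {}KM : K `<=` `[- (`|M| + 1), `|M| + 1].
    move=> x Kx; rewrite /= in_itv/= -ler_norml.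
    by apply: (KM (`|M| + 1)) => //; rewrite (le_lt_trans (ler_norm M))// ltrDl.
  have /integrableP[_] := integrable_weighted_bounded (- (`|M| + 1)) (`|M| + 1).
  apply: le_lt_trans; apply: ge0_subset_integral => //.
    exact: compact_measurable.
  by apply: measurable_funTS; apply: measurableT_comp => //; exact: measurableT_comp.
have : forall n : nat, {ae mu, forall x, - n%:R < x -> f x = 0}.
  move=> n.
  have := @FTC1 _ f (BLeft (- n%:R)) _ locf.
  move=> /(_ (fun y => integrable_weighted_bounded _ _)).
  apply: filterS; first exact: (ae_filter_ringOfSetsType mu).
  move=> x Hx nx; have [_ <-] := Hx nx.
  rewrite (_ : (fun _ => _) = cst 0).
    by rewrite derive1_cst.
  apply/funext => z /=; have [nz|nz] := ltP (- n%:R) z; first exact: f0.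
  have [->|zn] := eqVneq z (- n%:R); first by rewrite set_itv1 Rintegral_set1.
  rewrite set_itv_ge ?Rintegral_set0// bnd_simp -ltNge lt_neqAle zn.
  exact: nz.
move=> /ae_foralln H; apply: (filterS _ H).
move=> x Hx.
apply: (Hx (Num.truncn `|x|).+1); rewrite ltrNl.
by rewrite (le_lt_trans (ler_norm _))// normrN truncnS_gt.
Qed.

Variables (al be : R).
Hypothesis albe : al < be.
Let A := `|al| + `|be|.
Local Notation P := poisson.
(** The angle under which the interval from [al] to [be] is seen from the point (x, y) of the upper
    half-plane. *)
Let K (y x : R) := atan ((be - x) / y) - atan ((al - x) / y).

Let integral_P (y x : R) : 0 < y -> \int[mu]_(a in `[al, be]) P y a x = K y x.
Proof.
move=> y0; rewrite /Rintegral.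
have dF (a : R) : is_derive a 1 (fun a => atan ((a - x) / y)) (P y a x).
  apply: is_derive_eq; rewrite /GRing.scale /= /P.
  have := lt0r_neq0 (poisson_den_gt0 a x y0); have := lt0r_neq0 y0 => yn0 dn0.
  by field; rewrite dn0 yn0.
have cF : continuous (fun a => atan ((a - x) / y)).
  move=> a; apply/differentiable_continuous/derivable1_diffP.
  exact: (@ex_derive _ _ _ _ _ _ _ (dF a)).
rewrite (@continuous_FTC2 _ _ (fun a => atan ((a - x) / y)))//.
- exact/continuous_subspaceT/continuous_poisson.
- split.
  + by move=> a _; exact: (@ex_derive _ _ _ _ _ _ _ (dF a)).
  + by apply: cvg_at_right_filter; exact: cF.
  + by apply: cvg_at_left_filter; exact: cF.
- by move=> a _; rewrite derive1E (@derive_val _ _ _ _ _ _ _ (dF a)).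
Qed.

(** The kernel for Fubini: [q] compensates the division in the integrable function f / q. The
    indicator also serves as the integrable function of [a]; its repetition here makes the kernel
    bounded for all [a], and it is idempotent. *)
Let c (y : R) (z : R * R) : R := \1_`[al, be] z.1 * (q z.2 * P y z.1 z.2).

Let measurable_c (y : R) : 0 < y -> measurable_fun setT (c y).
Proof.
move=> y0; apply: measurable_funM.
  by apply: measurableT_comp => //; exact: measurable_indic.
apply: measurable_funM.
  by apply: measurable_funD => //; apply: measurable_funX; exact: measurable_snd.
rewrite (_ : (fun _ => _) = (fun z : R * R => P y (z.1 - z.2) 0)); last first.
  by apply/funext => z; rewrite /poisson sub0r sqrrN -sqrrN opprB.
apply: (@measurableT_comp _ _ _ _ _ _ (P y ^~ 0) _ (fun z : R * R => z.1 - z.2)); last first.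
  exact: measurable_funB.
by apply: continuous_measurable_fun; exact: continuous_poisson.
Qed.

Let norm_le_A (a : R) : al <= a <= be -> `|a| <= A.
Proof.
move=> /andP[ala abe].
have := ler_norm be; have := ler_norm (- al); rewrite normrN ler_norml /A.
by have := normr_ge0 al; have := normr_ge0 be; move=> *; apply/andP; split; lra.
Qed.

Let norm_c_le (y : R) : 0 < y -> forall z, `|c y z| <= (1 + 2 * A ^+ 2) / y + 2 * y.
Proof.
move=> y0 [a x]; rewrite /c /= indicE.
have [/set_mem|_] := boolP (a \in `[al, be]%classic); rewrite ?mul1r ?mul0r.
  by rewrite /= in_itv/= => /norm_le_A; exact: norm_poisson_weight_le.
rewrite normr0 addr_ge0 ?mulr_ge0 ?(ltW y0) ?invr_ge0//.
- by rewrite addr_ge0// mulr_ge0// sqr_ge0.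
- exact: ltW.
Qed.

Let integrable_ind : mu.-integrable setT (EFin \o (\1_`[al, be] : R -> R)).
Proof. exact: integrable_indic_itv. Qed.

Let integral_c (y x : R) : 0 < y ->
  \int[mu]_a ((\1_`[al, be] : R -> R) a * c y (a, x)) = q x * K y x.
Proof.
move=> y0; rewrite -integral_P// -RintegralZl//; last first.
  apply: continuous_compact_integrable; first exact: segment_compact.
  exact/continuous_subspaceT/continuous_poisson.
rewrite [RHS]Rintegral_mkcond; apply: eq_Rintegral => a _.
rewrite patchE /c /= indicE; by case: (a \in _); rewrite ?mul1r ?mul0r.
Qed.

Let integral_K_eq0 (y : R) : 0 < y ->
  (forall a, \int[mu]_x (f x * P y a x) = 0) -> \int[mu]_x (f x * K y x) = 0.
Proof.
move=> y0 fP0.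
have := kernel_Fubini integrable_ind intf (measurable_c y0) (norm_c_le y0).
under eq_Rintegral => a _.
  rewrite (_ : _ * _ = 0); last first.
    rewrite /c /= indicE; case: (a \in _).
      rewrite mul1r -[RHS](fP0 a); apply: eq_Rintegral => x _.
      by rewrite mul1r mulrA divfK ?gt_eqF.
    by rewrite mul0r.
  over.
rewrite /Rintegral integral0 /= -/(Rintegral _ _ _) => ->; apply: eq_Rintegral => x _.
rewrite (_ : fine _ = q x * K y x); last exact: integral_c.
by rewrite mulrA divfK ?gt_eqF.
Qed.

Let K_ge0 (y x : R) : 0 < y -> 0 <= K y x.
Proof.
by move=> y0; rewrite subr_ge0 le_atan// ler_pM2r ?invr_gt0// lerD2r ltW.
Qed.

Let K_le_pi (y x : R) : K y x <= pi.
Proof.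
rewrite /K.
by have := atan_ltpi2 ((be - x) / y); have := atan_gtNpi2 ((al - x) / y); lra.
Qed.

Let measurable_K (y : R) : measurable_fun setT (K y).
Proof.
apply: measurable_funB.
all: apply: measurableT_comp; first exact: continuous_measurable_fun (@continuous_atan R).
all: by apply: measurable_funM => //; exact: measurable_funB.
Qed.

(** Integral over [a] of the bound in [poisson_weight_le], where the kernel contributes at most pi
    and y is at most 1. It is independent of y, so [B * |f / q|] dominates the whole sequence
    below. *)
Let B := (1 + 2 * A ^+ 2) * pi + 2 * (be - al).

Let qK_le (y x : R) : 0 < y -> y <= 1 -> `|q x * K y x| <= B.
Proof.
move=> y0 y1; rewrite ger0_norm; last by rewrite mulr_ge0 ?K_ge0// (ltW (q_gt0 x)).
have intP : mu.-integrable `[al, be] (EFin \o (P y ^~ x)).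
  apply: continuous_compact_integrable; first exact: segment_compact.
  exact/continuous_subspaceT/continuous_poisson.
have intcst r : mu.-integrable `[al, be] (EFin \o cst r).
  apply: continuous_compact_integrable; first exact: segment_compact.
  by apply: continuous_subspaceT => ?; exact: cvg_cst.
have intZ r : mu.-integrable `[al, be] (EFin \o (fun a => r * P y a x)).
  exact: integrable_mull.
rewrite -integral_P// -RintegralZl//.
apply: (@le_trans _ _ (\int[mu]_(a in `[al, be]) ((1 + 2 * A ^+ 2) * P y a x + 2 * y))).
  apply: le_Rintegral => //.
    by apply: integrable_add => //; exact: intcst.
  by move=> a /=; rewrite in_itv/= => /norm_le_A; exact: poisson_weight_le.
rewrite RintegralD//; last exact: intcst.
rewrite [X in X + _ <= _]RintegralZl// integral_P// Rintegral_cst//=.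
rewrite lebesgue_measure_itv/= lte_fin albe/=.
rewrite lerD//.
  by rewrite ler_wpM2l ?K_le_pi// addr_ge0// mulr_ge0// sqr_ge0.
by rewrite ler_wpM2r ?subr_ge0 ?(ltW albe)//; lra.
Qed.

Lemma Rintegral_interval_eq0 :
  (forall y a, 0 < y -> \int[mu]_x (f x * P y a x) = 0) ->
  \int[mu]_(x in `[al, be]) f x = 0.
Proof.
move=> fP0.
pose y_ (n : nat) : R := n.+1%:R^-1.
have y_gt0 n : 0 < y_ n by rewrite invr_gt0.
have y_le1 n : y_ n <= 1 by rewrite invf_le1// ler1n.
(* The limit angle: pi inside the interval, 0 outside and pi / 2 at the two end points, which form
   the null set discarded in [piind]. *)
pose L (x : R) : R := (Num.sg (be - x) - Num.sg (al - x)) * (pi / 2).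
have KL x : K (y_ n) x @[n --> \oo] --> L x.
  by rewrite /L mulrBl; apply: cvgB; exact: cvg_atan_dilation.
have mfK n : measurable_fun setT (EFin \o (fun x => f x * K (y_ n) x)).
  by apply/measurable_EFinP; exact: measurable_funM.
have cvgfK x : (f x * K (y_ n) x)%:E @[n --> \oo] --> (f x * L x)%:E.
  by apply: cvg_EFin; [exact: nearW|apply: cvgM; [exact: cvg_cst|exact: KL]].
have mfL : measurable_fun setT (EFin \o (fun x => f x * L x)).
  exact: emeasurable_fun_cvg (fun x _ => cvgfK x).
have intg : mu.-integrable setT (EFin \o (fun x => B * `|f x / q x|)).
  by apply: integrable_mull => //; exact: integrable_norm intf.
have := @dominated_convergence _ _ _ mu setT measurableT
   (fun n => EFin \o (fun x => f x * K (y_ n) x)) (EFin \o (fun x => f x * L x))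
   (EFin \o (fun x => B * `|f x / q x|)) mfK mfL.
case=> //.
- by apply/aeW => x _; exact: cvgfK.
- apply/aeW => x n _; rewrite /= lee_fin.
  rewrite (_ : f x * K _ x = (q x * K (y_ n) x) * (f x / q x)).
    by rewrite normrM ler_wpM2r// qK_le.
  by rewrite mulrC [q x * _]mulrC -mulrA [q x * _]mulrC divfK ?gt_eqF.
move=> intL _.
rewrite (_ : [sequence _]_n = cst 0%E); last first.
  apply/funext => n /=.
  rewrite -[LHS]fineK; first by congr EFin; apply: integral_K_eq0 => // a; exact: fP0.
  apply: integrable_fin_num => //.
  by apply: (@integrable_weighted_mul _ B) => // x; exact: qK_le.
move=> /(cvg_unique (@ereal_hausdorff R) (cvg_cst 0%E)) fL0.
have piind : \int[mu]_x (pi * (f \_ `[al, be]) x) = \int[mu]_x (f x * L x).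
  congr fine; apply: ae_eq_integral => //.
    apply/measurable_EFinP; apply: measurable_funM => //.
    by apply/(measurable_restrictT _ _).1 => //; exact: measurable_funTS.
  exists [set al; be]; split.
  - by apply: measurableU; exact: measurable_set1.
  - by apply: countable_lebesgue_measure0; apply: finite_set_countable; exact: finite_set2.
  - move=> x /=; apply: contra_notP => /not_orP[/eqP xal /eqP xbe] _.
    rewrite /L patchE; case: ifPn => [/set_mem|/negP xN] /=.
      rewrite /= in_itv/= => /andP[alx xb].
      rewrite gtr0_sg ?ltr0_sg ?subr_lt0 ?subr_gt0 ?lt_neqAle ?xbe// 1?eq_sym ?xal//.
      by congr EFin; field.
    have /orP[xal'|xbe'] : (x < al) || (be < x).
      rewrite !ltNge -negb_and; apply/negP => h; apply/xN/mem_set.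
      by rewrite /= in_itv.
    - by rewrite !gtr0_sg ?subr_gt0// ?(lt_trans xal')// subrr mul0r !mulr0.
    - by rewrite !ltr0_sg ?subr_lt0// ?(lt_trans albe)// subrr mul0r !mulr0.
move: piind; rewrite [RHS]/Rintegral -fL0.
rewrite (@RintegralZl _ _ _ mu setT (f \_ `[al, be]) pi)//; last first.
  have := integrable_weighted_bounded al be => /(integrable_mkcond _ _).1.
  rewrite restrict_EFin; exact.
rewrite -Rintegral_mkcond => /eqP; rewrite mulf_eq0 gt_eqF ?pi_gt0//= => /eqP.
exact.
Qed.

End PoissonVanish.

Lemma poisson_eq0_ae {R : realType} (f : R -> R) :
  lebesgue_measure.-integrable setT (EFin \o (fun x => f x / (1 + x ^+ 2))) ->
  (forall y a, 0 < y -> \int[lebesgue_measure]_x (f x * poisson y a x) = 0) ->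
  {ae lebesgue_measure, forall x, f x = 0}.
Proof.
move=> intf fP0; apply: Rintegral_intervals_eq0_ae => // a b ab.
exact: Rintegral_interval_eq0.
Qed.

(** * Poisson integrals bounded by the L2 norm of the transform *)

Section TransformBound.
Context {R : realType}.
Local Notation mu := (@lebesgue_measure R).

Section Kernel.
Variables (v : R -> R) (c : R * R -> R).
Hypotheses (intv : mu.-integrable setT (EFin \o v)) (mc : measurable_fun setT c)
  (c1 : forall z, `|c z| <= 1).

Let intvc w : mu.-integrable setT (EFin \o (fun x => v x * c (w, x))).
Proof. exact: (integrable_bounded_mul intv (measurableT_comp mc _) (fun x => c1 (w, x))). Qed.

Lemma norm_transform_le w :
  `|\int[mu]_x (v x * c (w, x))| <= \int[mu]_x `|v x|.
Proof.
rewrite (le_trans (le_normr_Rintegral measurableT (intvc w)))// le_Rintegral//.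
- exact: integrable_norm (intvc w).
- exact: integrable_norm intv.
- by move=> x _; rewrite normrM ler_piMr.
Qed.

(* The factor abel 1 makes w an integrable variable, so that the measurability
   part of Fubini's theorem applies; it is divided out afterwards. *)
Lemma measurable_transform :
  measurable_fun setT (fun w => \int[mu]_x (v x * c (w, x))).
Proof.
have -> : (fun w => \int[mu]_x (v x * c (w, x))) =
    (fun w => expR `|w| * (abel 1 w * \int[mu]_x (v x * c (w, x)))).
  by apply/funext => w; rewrite mulrA /abel mul1r -expRD subrr expR0 mul1r.
apply: measurable_funM; first by apply: measurableT_comp.
exact: measurable_kernel (integrable_abel ltr01) intv mc c1.
Qed.

Lemma integrable_abel_transform (y : R) : 0 < y ->
  mu.-integrable setT (EFin \o (fun w => abel y w * \int[mu]_x (v x * c (w, x)))).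
Proof.
move=> y0; apply: (integrable_bounded_mul (integrable_abel y0)).
- exact: measurable_transform.
- exact: norm_transform_le.
Qed.

End Kernel.

Lemma measurable_cos_shift (a : R) :
  measurable_fun setT (fun z : R * R => cos (z.1 * (z.2 - a))).
Proof.
apply: measurableT_comp; first exact: continuous_measurable_fun (@continuous_cos R).
by apply: measurable_funM => //; exact: measurable_funB.
Qed.

Lemma measurable_sin_shift (a : R) :
  measurable_fun setT (fun z : R * R => sin (z.1 * (z.2 - a))).
Proof.
apply: measurableT_comp; first exact: continuous_measurable_fun (@continuous_sin R).
by apply: measurable_funM => //; exact: measurable_funB.
Qed.

Lemma norm_cos_le1 (t : R) : `|cos t| <= 1.
Proof. by rewrite ler_norml cos_geN1 cos_le1. Qed.

Lemma norm_sin_le1 (t : R) : `|sin t| <= 1.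
Proof. by rewrite ler_norml sin_geN1 sin_le1. Qed.

Variables (v1 v2 : R -> R).
Hypotheses (intv1 : mu.-integrable setT (EFin \o v1))
  (intv2 : mu.-integrable setT (EFin \o v2)).
Variables (a y : R).
Hypothesis y0 : 0 < y.

Let T w : R := \int[mu]_x (v1 x * cos (w * (x - a))) +
               \int[mu]_x (v2 x * sin (w * (x - a))).

Let mc := measurable_cos_shift a.
Let ms := measurable_sin_shift a.

Let mT : measurable_fun setT T.
Proof.
apply: measurable_funD.
- exact: (measurable_transform intv1 mc (fun z => norm_cos_le1 _)).
- exact: (measurable_transform intv2 ms (fun z => norm_sin_le1 _)).
Qed.

Let ia1 := integrable_abel_transform intv1 mc (fun z => norm_cos_le1 _) y0.
Let ia2 := integrable_abel_transform intv2 ms (fun z => norm_sin_le1 _) y0.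

Let abel_sin0 (u : R) : \int[mu]_w (abel y w * sin (w * u)) = 0.
Proof.
apply: Rintegral_odd.
  apply: integrable_bounded_mul (integrable_abel y0) _ (fun w => norm_sin_le1 _).
  apply: measurableT_comp; first exact: continuous_measurable_fun (@continuous_sin R).
  exact: measurable_funM.
by move=> w; rewrite abelN mulNr sinN mulrN.
Qed.

(** After exchanging the integrals, [abel] is paired with a cosine and with a sine in w. It is even,
    so the sine part vanishes and [v2] disappears: this isolates one real component of the
    function. *)
Let abel_T : \int[mu]_w (abel y w * T w) = \int[mu]_x (v1 x * (2 * poisson y a x)).
Proof.
transitivity (\int[mu]_w (abel y w * \int[mu]_x (v1 x * cos (w * (x - a))) +
                          abel y w * \int[mu]_x (v2 x * sin (w * (x - a))))).
  by apply: eq_Rintegral => w _; rewrite -mulrDr.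
rewrite RintegralD//.
rewrite (kernel_Fubini (integrable_abel y0) intv1 mc (fun z => norm_cos_le1 _)).
rewrite (kernel_Fubini (integrable_abel y0) intv2 ms (fun z => norm_sin_le1 _)) /=.
under [X in _ + X]eq_Rintegral do rewrite abel_sin0 mulr0.
rewrite [X in _ + X]/Rintegral integral0/= addr0.
apply: eq_Rintegral => x _; congr (_ * _).
under eq_Rintegral do rewrite [_ * (x - a)]mulrC.
by rewrite Rintegral_abel_cos// /poisson mulrA.
Qed.

(** The Cauchy-Schwarz inequality applied to [abel_T]. The factor coming from [abel] depends on y
    alone, so it stays fixed while the truncation of the function varies. *)
Lemma poisson_le_Lnorm (E : \bar R) : (Lnorm mu 2%:E (EFin \o T) <= E)%E ->
  (`|\int[mu]_x (v1 x * (2 * poisson y a x))|%:E <=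
   Lnorm mu 2%:E (EFin \o abel y) * E)%E.
Proof.
move=> TE; rewrite -abel_T.
have intaT : mu.-integrable setT (EFin \o (fun w => abel y w * T w)).
  have := integrable_add measurableT ia1 ia2.
  by apply: eq_integrable => // w _ /=; rewrite -mulrDr.
apply: (@le_trans _ _ (Lnorm mu 1 (EFin \o (abel y \* T)))).
  rewrite Lnorm1 EFin_normr_Rintegral//.
  by apply: le_abse_integral => //; exact: measurable_int intaT.
apply: le_trans (@hoelder _ _ _ mu (abel y) T 2 2 _ mT _ _ _) _ => //.
- exact: measurable_abel.
- by field.
by rewrite lee_wpmul2l// Lnorm_ge0.
Qed.

End TransformBound.

Lemma Lnorm_abel_fin {R : realType} (y : R) : 0 < y ->
  Lnorm (@lebesgue_measure R) 2%:E (EFin \o abel y) \is a fin_num.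
Proof.
move=> y0; rewrite ge0_fin_numE ?Lnorm_ge0//.
rewrite unlock /= poweR_lty//.
have y20 : 0 < 2 * y by rewrite mulr_gt0.
have /integrableP[_] := integrable_abel y20.
apply: le_lt_trans; rewrite le_eqVlt; apply/orP; left; apply/eqP.
apply: eq_integral => w _ /=; rewrite -abel_sqr.
by rewrite powR_mulrn// normrX.
Qed.

(** * Uniqueness of the L2 Fourier transform *)

Local Open Scope complex_scope.

Section Uniqueness.
Context {R : realType}.
Local Notation mu := (@lebesgue_measure R).

Definition cosft (v : R -> R) (w : R) : R := \int[mu]_x (v x * cos (w * x)).
Definition sinft (v : R -> R) (w : R) : R := \int[mu]_x (v x * sin (w * x)).

Lemma measurable_cosM (w : R) : measurable_fun setT (fun x : R => cos (w * x)).
Proof.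
apply: measurableT_comp; first exact: continuous_measurable_fun (@continuous_cos R).
exact: measurable_funM.
Qed.

Lemma measurable_sinM (w : R) : measurable_fun setT (fun x : R => sin (w * x)).
Proof.
apply: measurableT_comp; first exact: continuous_measurable_fun (@continuous_sin R).
exact: measurable_funM.
Qed.

Lemma integrable_mul_cos (v : R -> R) (w : R) : mu.-integrable setT (EFin \o v) ->
  mu.-integrable setT (EFin \o (fun x => v x * cos (w * x))).
Proof.
move=> iv; exact: integrable_bounded_mul iv (measurable_cosM w) (fun x => norm_cos_le1 _).
Qed.

Lemma integrable_mul_sin (v : R -> R) (w : R) : mu.-integrable setT (EFin \o v) ->
  mu.-integrable setT (EFin \o (fun x => v x * sin (w * x))).
Proof.
move=> iv; exact: integrable_bounded_mul iv (measurable_sinM w) (fun x => norm_sin_le1 _).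
Qed.

Lemma cosft_shift (v : R -> R) (w a : R) : mu.-integrable setT (EFin \o v) ->
  \int[mu]_x (v x * cos (w * (x - a))) = cos (w * a) * cosft v w + sin (w * a) * sinft v w.
Proof.
move=> iv; have ic := integrable_mul_cos w iv; have is_ := integrable_mul_sin w iv.
rewrite /cosft /sinft -!RintegralZl// -RintegralD//; try exact: integrable_mull.
by apply: eq_Rintegral => x _; rewrite mulrBr cosB; ring.
Qed.

Lemma sinft_shift (v : R -> R) (w a : R) : mu.-integrable setT (EFin \o v) ->
  \int[mu]_x (v x * sin (w * (x - a))) = cos (w * a) * sinft v w - sin (w * a) * cosft v w.
Proof.
move=> iv; have ic := integrable_mul_cos w iv; have is_ := integrable_mul_sin w iv.
rewrite /cosft /sinft -!RintegralZl// -RintegralB//; try exact: integrable_mull.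
by apply: eq_Rintegral => x _; rewrite mulrBr sinB; ring.
Qed.

Lemma measurable_cosft (v : R -> R) : mu.-integrable setT (EFin \o v) ->
  measurable_fun setT (cosft v).
Proof.
move=> iv; have := measurable_transform iv (measurable_cos_shift 0) (fun z => norm_cos_le1 _).
by apply: eq_measurable_fun => w _; apply: eq_Rintegral => x _; rewrite subr0.
Qed.

Lemma measurable_sinft (v : R -> R) : mu.-integrable setT (EFin \o v) ->
  measurable_fun setT (sinft v).
Proof.
move=> iv; have := measurable_transform iv (measurable_sin_shift 0) (fun z => norm_sin_le1 _).
by apply: eq_measurable_fun => w _; apply: eq_Rintegral => x _; rewrite subr0.
Qed.

Definition window (f : R -> R) (n : nat) : R -> R := f \_ `[- n%:R, n%:R].

(* The weight admits L2 functions as well as integrable ones, and makes f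
   integrable against a Poisson kernel. *)
Definition weighted (f : R -> R) :=
  mu.-integrable setT (EFin \o (fun x => f x / (1 + x ^+ 2))).

Lemma weighted_window (f : R -> R) (n : nat) : weighted f ->
  mu.-integrable setT (EFin \o window f n).
Proof.
move=> wf; have := integrable_weighted_bounded wf (- n%:R) n%:R.
by move=> /(integrable_mkcond _ _).1; rewrite restrict_EFin; exact.
Qed.

Lemma truncated_fourierE (d : R -> R[i]) (n : nat) (w : R) :
  weighted (fun x => complex.Re (d x)) -> weighted (fun x => complex.Im (d x)) ->
  let v1 := window (fun x => complex.Re (d x)) n in
  let v2 := window (fun x => complex.Im (d x)) n in
  truncated_fourier d n w =
  (cosft v1 w + sinft v2 w) +i* (cosft v2 w - sinft v1 w).
Proof.
move=> wre wim v1 v2.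
have i1 : mu.-integrable setT (EFin \o v1) by exact: weighted_window.
have i2 : mu.-integrable setT (EFin \o v2) by exact: weighted_window.
have ic1 := integrable_mul_cos w i1; have is1 := integrable_mul_sin w i1.
have ic2 := integrable_mul_cos w i2; have is2 := integrable_mul_sin w i2.
rewrite /truncated_fourier /cintegral /cosft /sinft -RintegralD// -RintegralB//.
congr (_ +i* _); rewrite Rintegral_mkcond; apply: eq_Rintegral => x _;
  rewrite /v1 /v2 /window !patchE; case: (x \in _); rewrite ?mul0r ?addr0 ?subr0//=;
  rewrite /cis; case: (d x) => u v /=; rewrite cosN sinN; ring.
Qed.

(** The left side is the modulus of the real part of e^(-it) (X + iY); the difference of the squares
    is the square of the imaginary part. *)
Lemma rotation_le_normc (t X Y : R) :
  `|cos t * X + sin t * Y| <= Normc.normc (X +i* Y).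
Proof.
rewrite -sqrtr_sqr /= ler_sqrt ?addr_ge0 ?sqr_ge0//.
rewrite -subr_ge0 (_ : _ - _ = (cos t * Y - sin t * X) ^+ 2) ?sqr_ge0//.
by rewrite -[X in X - _]mul1r -(cos2Dsin2 t); ring.
Qed.

Lemma Lnorm2_le (S N : R -> R) :
  measurable_fun setT S -> measurable_fun setT N ->
  (forall w, `|S w| <= N w) ->
  (Lnorm mu 2%:E (EFin \o S) <= Lnorm mu 2%:E (EFin \o N))%E.
Proof.
move=> mS mN SN; rewrite unlock /= gt0_ler_poweR ?invr_ge0//.
- by rewrite in_itv/= leey andbT integral_ge0.
- by rewrite in_itv/= leey andbT integral_ge0.
have mp (h : R -> R) : measurable_fun setT h ->
    measurable_fun setT (fun x => (`|h x| `^ 2)%:E).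
  move=> mh; apply/measurable_EFinP.
  apply: (@measurableT_comp _ _ _ _ _ _ (fun x : R => x `^ 2)) => //.
  exact: measurableT_comp.
apply: ge0_le_integral => //=; [exact: mp | exact: mp |].
move=> w _; rewrite lee_fin ge0_ler_powR ?nnegrE//.
by rewrite (le_trans (SN w))// ler_norm.
Qed.

(* The two integrals add up to the real part of e^(iwa) times the transform of
   f1 + i f2 truncated to [-n, n]. *)
Lemma fourier_core (f1 f2 : R -> R) (e : nat -> \bar R) :
  weighted f1 -> weighted f2 -> e n @[n --> \oo] --> 0%E ->
  (forall n a, (Lnorm mu 2%:E (EFin \o (fun w : R =>
     \int[mu]_x (window f1 n x * cos (w * (x - a))) +
     \int[mu]_x (window f2 n x * sin (w * (x - a))))%R) <= e n)%E) ->
  {ae mu, forall x, f1 x = 0}.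
Proof.
move=> wf1 wf2 e0 He; apply: poisson_eq0_ae => // y a y0.
pose P x : R := 2 * poisson y a x.
have mP : measurable_fun setT P.
  by apply: measurable_funM => //; exact: measurable_poisson.
have intfP : mu.-integrable setT (EFin \o (fun x => f1 x * P x)).
  apply: (@integrable_weighted_mul _ _ wf1 _ (2 * ((1 + 2 * `|a| ^+ 2) / y + 2 * y))) => // x.
  rewrite /P mulrCA normrM ger0_norm// ler_wpM2l//.
  exact: norm_poisson_weight_le.
have intwP n : mu.-integrable setT (EFin \o (fun x => window f1 n x * P x)).
  apply: (le_integrable measurableT _ _ intfP).
    apply/measurable_EFinP; apply: measurable_funM => //.
    by apply/measurable_EFinP; exact: measurable_int (weighted_window n wf1).
  move=> x _ /=; rewrite lee_fin !normrM ler_wpM2r// /window patchE.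
  by case: ifP => // _; rewrite normr0.
(* The integrals of the windowed [f1] against [P] have two limits: the full integral by dominated
   convergence, since each x lies in the window once n >= |x|, and 0 by [poisson_le_Lnorm]. *)
have [] := @dominated_convergence _ _ _ mu setT measurableT
   (fun n => EFin \o (fun x => window f1 n x * P x)) (EFin \o (fun x => f1 x * P x))
   (EFin \o (fun x => `|f1 x * P x|)).
- by move=> n; exact: measurable_int (intwP n).
- exact: measurable_int intfP.
- apply/aeW => x _; apply: cvg_near_cst.
  near=> n; rewrite /= /window patchE mem_set//= in_itv/= -ler_norml.
  by near: n; exact: nbhs_infty_ger.
- exact: integrable_norm intfP.
- apply/aeW => x n _; rewrite /= lee_fin !normrM ler_wpM2r// /window patchE.
  by case: ifP => // _; rewrite normr0.
move=> _ _ lim1.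
have lim0 : (\int[mu]_x (window f1 n x * P x)%:E)%E @[n --> \oo] --> 0%E.
  apply/cvg_abse0P.
  apply: (@squeeze_cvge _ _ _ _ (cst 0%E) _
    (fun n => Lnorm mu 2%:E (EFin \o abel y) * e n)%E).
  - apply: nearW => n; rewrite abse_ge0 /= -EFin_normr_Rintegral//.
    by apply: (@poisson_le_Lnorm _ _ (window f2 n)) => //; exact: weighted_window.
  - exact: cvg_cst.
  - rewrite -(mule0 (Lnorm mu 2%:E (EFin \o abel y))).
    by apply: cvgeZl => //; exact: Lnorm_abel_fin.
have E := cvg_unique (@ereal_hausdorff R) lim1 lim0.
have : \int[mu]_x (2 * (f1 x * poisson y a x)) = 0.
  rewrite -[RHS]/(fine 0%E) -E; congr fine; apply: eq_integral => x _ /=.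
  by rewrite /P mulrCA.
rewrite RintegralZl//; last first.
  have := integrable_mull measurableT 2^-1 intfP.
  by apply: eq_integrable => // x _ /=; rewrite /P; congr EFin; field.
by move=> /eqP; rewrite mulf_eq0 pnatr_eq0/= => /eqP.
Unshelve. all: by end_near. Qed.

End Uniqueness.

(** * Uniqueness for complex-valued L2 functions *)

Section UniquenessL2.
Context {R : realType}.
Local Notation mu := (@lebesgue_measure R).

Lemma integrable_oneDsqrV :
  mu.-integrable setT (EFin \o (fun x : R => (1 + x ^+ 2)^-1)).
Proof.
apply/integrableP; split.
  by apply/measurable_EFinP; apply: continuous_measurable_fun; exact: continuous_oneDsqrV.
have q0 (x : R) : 0 <= (1 + x ^+ 2)^-1 by rewrite invr_ge0 addr_ge0// sqr_ge0.
under eq_integral do rewrite /= ger0_norm//.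
rewrite (ge0_symfun_integralT q0); last 2 first.
- exact: continuous_oneDsqrV.
- by move=> x /=; rewrite sqrrN.
by rewrite -set_itvcy -[X in (_ * X)%E]/(\int[mu]_(x in `[0%R, +oo[) (oneDsqr x)^-1%:E)%E
  integral0y_oneDsqr -EFinM ltry.
Qed.

(** With v = 1 / (1 + x^2) <= 1, 2 |f| v <= f^2 + v^2 gives |f| v <= f^2 + v, a sum of two
    integrable functions. *)
Lemma weighted_Lfun2 (f : R -> R) : f \in Lfun mu 2%:E -> weighted f.
Proof.
move=> f2; have i2 := Lfun2_integrable_sqr f2.
apply: (le_integrable measurableT _ _ (integrable_add measurableT i2 integrable_oneDsqrV)).
  apply/measurable_EFinP; apply: measurable_funM.
    by move: f2; rewrite inE => /andP[]; rewrite inE.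
  by apply: continuous_measurable_fun; exact: continuous_oneDsqrV.
move=> x _ /=; rewrite lee_fin normrM.
have q1 : 1 <= 1 + x ^+ 2 by rewrite lerDl sqr_ge0.
have Q0 : 0 <= (1 + x ^+ 2)^-1 by rewrite invr_ge0 (le_trans ler01).
have Q1 : (1 + x ^+ 2)^-1 <= 1 by rewrite invf_le1// (lt_le_trans ltr01).
rewrite (ger0_norm Q0) [leRHS]ger0_norm ?addr_ge0 ?sqr_ge0// -[f x ^+ 2]real_normK ?num_real//.
have := sqr_ge0 (`|f x| - (1 + x ^+ 2)^-1); have := normr_ge0 (f x).
move: (`|f x|) ((1 + x ^+ 2)^-1) Q0 Q1 => u v *; nra.
Qed.

Lemma weighted_sub (f g : R -> R) : weighted f -> weighted g ->
  weighted (fun x => f x - g x).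
Proof.
move=> wf wg; have := integrable_sub measurableT wf wg.
by apply: eq_integrable => // x _ /=; rewrite mulrBl.
Qed.

Lemma weighted_opp (f : R -> R) : weighted f -> weighted (fun x => - f x).
Proof.
move=> wf; have := integrable_mull measurableT (-1) wf.
by apply: eq_integrable => // x _ /=; rewrite mulN1r mulNr.
Qed.

Lemma integrable_weighted (f : R -> R) : mu.-integrable setT (EFin \o f) -> weighted f.
Proof.
move=> intf; apply: (integrable_bounded_mul (M := 1) intf).
  by apply: continuous_measurable_fun; exact: continuous_oneDsqrV.
move=> x; rewrite ger0_norm; first exact: oneDsqrV_le1.
by rewrite invr_ge0 addr_ge0// sqr_ge0.
Qed.

Lemma windowB (f g : R -> R) n :
  window (fun x => f x - g x) n = (fun x => window f n x - window g n x).
Proof. by apply/funext => x; rewrite /window !patchE; case: ifP => //; rewrite subr0. Qed.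

Lemma windowN (f : R -> R) n : window (fun x => - f x) n = (fun x => - window f n x).
Proof. by apply/funext => x; rewrite /window !patchE; case: ifP => //; rewrite oppr0. Qed.

Lemma cosftB (u v : R -> R) (w : R) :
  mu.-integrable setT (EFin \o u) -> mu.-integrable setT (EFin \o v) ->
  cosft (fun x => u x - v x) w = cosft u w - cosft v w.
Proof.
move=> iu iv; rewrite /cosft -RintegralB//; try exact: integrable_mul_cos.
by apply: eq_Rintegral => x _; rewrite mulrBl.
Qed.

Lemma sinftB (u v : R -> R) (w : R) :
  mu.-integrable setT (EFin \o u) -> mu.-integrable setT (EFin \o v) ->
  sinft (fun x => u x - v x) w = sinft u w - sinft v w.
Proof.
move=> iu iv; rewrite /sinft -RintegralB//; try exact: integrable_mul_sin.
by apply: eq_Rintegral => x _; rewrite mulrBl.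
Qed.

Lemma cosftN (u : R -> R) (w : R) : mu.-integrable setT (EFin \o u) ->
  cosft (fun x => - u x) w = - cosft u w.
Proof.
move=> iu; rewrite /cosft -mulN1r -RintegralZl//; last exact: integrable_mul_cos.
by apply: eq_Rintegral => x _; rewrite mulN1r mulNr.
Qed.

Lemma sinftN (u : R -> R) (w : R) : mu.-integrable setT (EFin \o u) ->
  sinft (fun x => - u x) w = - sinft u w.
Proof.
move=> iu; rewrite /sinft -mulN1r -RintegralZl//; last exact: integrable_mul_sin.
by apply: eq_Rintegral => x _; rewrite mulN1r mulNr.
Qed.

Lemma truncated_fourierB (f g : R -> R[i]) n w :
  weighted (fun x => complex.Re (f x)) -> weighted (fun x => complex.Im (f x)) ->
  weighted (fun x => complex.Re (g x)) -> weighted (fun x => complex.Im (g x)) ->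
  truncated_fourier (fun x => f x - g x) n w =
  truncated_fourier f n w - truncated_fourier g n w.
Proof.
move=> fr fi gr gi.
have er : (fun x => complex.Re (f x - g x)) = (fun x => complex.Re (f x) - complex.Re (g x)).
  by apply/funext => x; case: (f x) => a b; case: (g x).
have ei : (fun x => complex.Im (f x - g x)) = (fun x => complex.Im (f x) - complex.Im (g x)).
  by apply/funext => x; case: (f x) => a b; case: (g x).
rewrite !truncated_fourierE// ?er ?ei; try exact: weighted_sub.
rewrite !windowB !cosftB ?sinftB; try exact: weighted_window.
by apply/eqP; rewrite eq_complex /=; apply/andP; split; apply/eqP; ring.
Qed.

Section Zero.
Variable d : R -> R[i].
Hypotheses (dr : weighted (fun x => complex.Re (d x)))
           (di : weighted (fun x => complex.Im (d x))).
Hypothesis d0 : L2norm (truncated_fourier d n) @[n --> \oo] --> 0%E.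

Let re n := window (fun x => complex.Re (d x)) n.
Let im n := window (fun x => complex.Im (d x)) n.
Let i1 n : mu.-integrable setT (EFin \o re n) := weighted_window n dr.
Let i2 n : mu.-integrable setT (EFin \o im n) := weighted_window n di.

Let measurable_normc n : measurable_fun setT (fun w => Normc.normc (truncated_fourier d n w)).
Proof.
rewrite (_ : (fun _ => _) = (fun w => Num.sqrt (
  (cosft (re n) w + sinft (im n) w) ^+ 2 +
  (cosft (im n) w - sinft (re n) w) ^+ 2))).
  apply: measurableT_comp; first exact: continuous_measurable_fun (@sqrt_continuous R).
  apply: measurable_funD; apply: measurable_funX.
    by apply: measurable_funD; [exact: measurable_cosft | exact: measurable_sinft].
  by apply: measurable_funB; [exact: measurable_cosft | exact: measurable_sinft].
by apply/funext => w; rewrite truncated_fourierE.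
Qed.

Let measurable_T u v a :
  mu.-integrable setT (EFin \o u) -> mu.-integrable setT (EFin \o v) ->
  measurable_fun setT (fun w : R => \int[mu]_x (u x * cos (w * (x - a))) +
                                    \int[mu]_x (v x * sin (w * (x - a)))).
Proof.
move=> iu iv; apply: measurable_funD.
- exact: (measurable_transform iu (measurable_cos_shift a) (fun z => norm_cos_le1 _)).
- exact: (measurable_transform iv (measurable_sin_shift a) (fun z => norm_sin_le1 _)).
Qed.

Lemma fourier_eq0_ae : {ae mu, forall x, d x = 0}.
Proof.
have re0 : {ae mu, forall x, complex.Re (d x) = 0}.
  apply: (fourier_core dr di d0) => n a; apply: Lnorm2_le => //.
    exact: measurable_T.
  move=> w; rewrite cosft_shift ?sinft_shift// truncated_fourierE//.
  rewrite [X in `|X| <= _](_ : _ = cos (- (w * a)) * (cosft (re n) w + sinft (im n) w) +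
      sin (- (w * a)) * (cosft (im n) w - sinft (re n) w)).
    exact: rotation_le_normc.
  by rewrite cosN sinN; ring.
(* The same argument for -i d = Im d - i Re d, whose transform has the same modulus as that of d. *)
have im0 : {ae mu, forall x, complex.Im (d x) = 0}.
  have i1N n : mu.-integrable setT (EFin \o window (fun x => - complex.Re (d x)) n).
    exact/weighted_window/weighted_opp.
  apply: (fourier_core di (weighted_opp dr) d0) => n a; apply: Lnorm2_le => //.
    exact: measurable_T.
  move=> w; rewrite cosft_shift ?sinft_shift// truncated_fourierE//.
  rewrite windowN cosftN ?sinftN//.
  rewrite [X in `|X| <= _](_ : _ = cos (w * a) * (cosft (im n) w - sinft (re n) w) +
      sin (w * a) * (cosft (re n) w + sinft (im n) w)); last by ring.
  by apply: le_trans (rotation_le_normc _ _ _) _ => /=; rewrite addrC.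
apply: (filterS2 (ae_filter_ringOfSetsType mu) _ re0 im0) => x.
by case: (d x) => a b /= -> ->.
Qed.

End Zero.

(** Past [N] the truncated transform of g equals F exactly, so that of f - g is the very error term
    that tends to 0 in the definition of the transform of f. *)
Lemma fourier_transform_unique (f g F : _ -> R[i]) (N : nat) :
  is_fourier_transform f F ->
  weighted (fun x => complex.Re (g x)) -> weighted (fun x => complex.Im (g x)) ->
  (forall n w, (N <= n)%N -> truncated_fourier g n w = F w) ->
  {ae mu, forall x, f x = g x}.
Proof.
move=> [[fr fi] _ fF] gr gi gF.
move: fr fi => /weighted_Lfun2 fr /weighted_Lfun2 fi.
have : {ae mu, forall x, f x - g x = 0}.
  apply: fourier_eq0_ae.
  - have := weighted_sub fr gr; congr weighted; apply/funext => x.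
    by case: (f x) => a b; case: (g x).
  - have := weighted_sub fi gi; congr weighted; apply/funext => x.
    by case: (f x) => a b; case: (g x).
  apply: cvg_trans fF; apply: near_eq_cvg; near=> n.
  congr L2norm; apply/funext => w; rewrite truncated_fourierB// gF//.
  by near: n; exact: nbhs_infty_ge.
by apply: (@filterS _ _ (ae_filter_ringOfSetsType mu)) => x /eqP; rewrite subr_eq0 => /eqP.
Unshelve. all: by end_near. Qed.

End UniquenessL2.

(** * Fourier integrals of compactly supported functions *)

Section CompactSupport.
Context {R : realType}.
Local Notation mu := (@lebesgue_measure R).
Implicit Types g u v : R -> R.

(** A class closed under everything the recursions do: multiplication by x, shifts and linear
    combinations. Its members and their products with x are integrable. *)
Definition bounded_support g : Prop := measurable_fun setT g /\
  exists M B : R, forall x, `|g x| <= B /\ (M < `|x| -> g x = 0).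

Lemma bounded_support_integrable g : bounded_support g ->
  mu.-integrable setT (EFin \o g).
Proof.
move=> [mg [M [B gMB]]].
have iM : mu.-integrable setT (EFin \o (\1_`[- M, M] : R -> R)) by exact: integrable_indic_itv.
have := integrable_bounded_mul iM mg (fun x => (gMB x).1).
apply: eq_integrable => // x _ /=; rewrite indicE; congr EFin.
have [_|/negP xN] := boolP (x \in `[- M, M]%classic); rewrite ?mul1r//.
rewrite mul0r (gMB x).2// ltNge; apply/negP => h; apply/xN/mem_set.
by rewrite /= in_itv/= -ler_norml.
Qed.

Lemma bounded_support_mulx g : bounded_support g -> bounded_support (fun x => x * g x).
Proof.
move=> [mg [M [B gMB]]]; split; first exact: measurable_funM.
exists M, (`|M| * `|B|) => x; have [gB g0] := gMB x; split; last first.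
  by move/g0 => ->; rewrite mulr0.
have [xM|xM] := leP `|x| M; last by rewrite g0// mulr0 normr0 mulr_ge0.
by rewrite normrM ler_pM// ?(le_trans xM) ?(le_trans gB) ?ler_norm.
Qed.

Lemma bounded_support_shift g (a : R) : bounded_support g ->
  bounded_support (fun x => g (x + a)).
Proof.
move=> [mg [M [B gMB]]]; split.
  by apply: (measurableT_comp mg); exact: measurable_funD.
exists (M + `|a|), B => x; have [gB g0] := gMB (x + a); split=> // Mx; apply: g0.
by rewrite -(ltrD2r `|a|) (lt_le_trans Mx)// -[X in `|X| <= _](addrK a) ler_normB.
Qed.

Lemma bounded_support_lin g g' (a b : R) : bounded_support g -> bounded_support g' ->
  bounded_support (fun x => a * g x + b * g' x).
Proof.
move=> [mg [M [B gMB]]] [mg' [M' [B' gMB']]]; split.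
  by apply: measurable_funD; exact: measurable_funM.
exists (Num.max M M'), (`|a| * B + `|b| * B') => x.
have [gB g0] := gMB x; have [gB' g0'] := gMB' x; split.
  by rewrite (le_trans (ler_normD _ _))// !normrM lerD// ler_wpM2l.
by rewrite gt_max => /andP[/g0 -> /g0' ->]; rewrite !mulr0 addr0.
Qed.

Lemma cosft_lin u v (a b w : R) :
  mu.-integrable setT (EFin \o u) -> mu.-integrable setT (EFin \o v) ->
  cosft (fun x => a * u x + b * v x) w = a * cosft u w + b * cosft v w.
Proof.
move=> iu iv; have cu := integrable_mul_cos w iu; have cv := integrable_mul_cos w iv.
rewrite /cosft -!RintegralZl// -RintegralD//; try exact: integrable_mull.
by apply: eq_Rintegral => x _; ring.
Qed.

Lemma sinft_lin u v (a b w : R) :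
  mu.-integrable setT (EFin \o u) -> mu.-integrable setT (EFin \o v) ->
  sinft (fun x => a * u x + b * v x) w = a * sinft u w + b * sinft v w.
Proof.
move=> iu iv; have cu := integrable_mul_sin w iu; have cv := integrable_mul_sin w iv.
rewrite /sinft -!RintegralZl// -RintegralD//; try exact: integrable_mull.
by apply: eq_Rintegral => x _; ring.
Qed.

Lemma cosft_translate u (a w : R) : mu.-integrable setT (EFin \o u) ->
  cosft (fun x => u (x + a)) w = cos (w * a) * cosft u w + sin (w * a) * sinft u w.
Proof.
move=> iu; rewrite -cosft_shift// -(Rintegral_shift a).
  by apply: eq_Rintegral => x _; rewrite addrK.
apply: (integrable_bounded_mul (M := 1) iu) => [|x]; last exact: norm_cos_le1.
exact: (measurable_fun_pair2 w (measurable_cos_shift a)).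
Qed.

Lemma sinft_translate u (a w : R) : mu.-integrable setT (EFin \o u) ->
  sinft (fun x => u (x + a)) w = cos (w * a) * sinft u w - sin (w * a) * cosft u w.
Proof.
move=> iu; rewrite -sinft_shift// -(Rintegral_shift a).
  by apply: eq_Rintegral => x _; rewrite addrK.
apply: (integrable_bounded_mul (M := 1) iu) => [|x]; last exact: norm_sin_le1.
exact: (measurable_fun_pair2 w (measurable_sin_shift a)).
Qed.

Section Derivative.
Variable g : R -> R.
Hypotheses (ig : mu.-integrable setT (EFin \o g))
  (ixg : mu.-integrable setT (EFin \o (fun x => x * g x))).
Variable w : R.

(** Differentiation under the integral sign works on an open interval around w. The radius 1 is
    arbitrary: |x g(x)| dominates the derivative for every frequency. *)
Let w_in : `]w - 1, w + 1[%classic w.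
Proof. by rewrite /= in_itv/=; apply/andP; split; lra. Qed.

Let dcos (x w0 : R) : is_derive w0 1 (fun w => g x * cos (w * x)) (- (x * g x * sin (w0 * x))).
Proof. by apply: is_derive_eq; rewrite /GRing.scale/=; ring. Qed.

Let dsin (x w0 : R) : is_derive w0 1 (fun w => g x * sin (w * x)) (x * g x * cos (w0 * x)).
Proof. by apply: is_derive_eq; rewrite /GRing.scale/=; ring. Qed.

Lemma is_derive_cosft : is_derive w 1 (cosft g) (- sinft (fun x => x * g x) w).
Proof.
have D0 (w0 x : R) : derivable (fun w : R => g x * cos (w * x)) w0 1.
  exact: (@ex_derive _ _ _ _ _ _ _ (dcos x w0)).
have D1 (w0 x : R) : partial1of2 (fun w x : R => g x * cos (w * x)) w0 x =
    - (x * g x * sin (w0 * x)).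
  by rewrite partial1of2E (@derive_val _ _ _ _ _ _ _ (dcos x w0)).
have inorm := integrable_norm ixg.
have ub w0 x : `]w - 1, w + 1[%classic w0 -> [set: R] x ->
    `|partial1of2 (fun w x : R => g x * cos (w * x)) w0 x| <= `|x * g x|.
  by move=> _ _; rewrite D1 normrN normrM ler_piMr// norm_sin_le1.
have i0 w0 : `]w - 1, w + 1[%classic w0 ->
    mu.-integrable setT (EFin \o (fun x => g x * cos (w0 * x))).
  by move=> _; exact: integrable_mul_cos.
apply: DeriveDef.
  exact: (derivable_under_integral measurableT w_in i0 (fun w0 x _ _ => D0 w0 x)
    (fun x => normr_ge0 _) inorm ub).
rewrite -derive1E.
rewrite (differentiation_under_integral measurableT w_in i0 (fun w0 x _ _ => D0 w0 x)
    (fun x => normr_ge0 _) inorm ub).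
rewrite /sinft -mulN1r -RintegralZl//; last exact: integrable_mul_sin.
by apply: eq_Rintegral => x _; rewrite D1 mulN1r.
Qed.

Lemma is_derive_sinft : is_derive w 1 (sinft g) (cosft (fun x => x * g x) w).
Proof.
have D0 (w0 x : R) : derivable (fun w : R => g x * sin (w * x)) w0 1.
  exact: (@ex_derive _ _ _ _ _ _ _ (dsin x w0)).
have D1 (w0 x : R) : partial1of2 (fun w x : R => g x * sin (w * x)) w0 x =
    x * g x * cos (w0 * x).
  by rewrite partial1of2E (@derive_val _ _ _ _ _ _ _ (dsin x w0)).
have inorm := integrable_norm ixg.
have ub w0 x : `]w - 1, w + 1[%classic w0 -> [set: R] x ->
    `|partial1of2 (fun w x : R => g x * sin (w * x)) w0 x| <= `|x * g x|.
  by move=> _ _; rewrite D1 normrM ler_piMr// norm_cos_le1.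
have i0 w0 : `]w - 1, w + 1[%classic w0 ->
    mu.-integrable setT (EFin \o (fun x => g x * sin (w0 * x))).
  by move=> _; exact: integrable_mul_sin.
apply: DeriveDef.
  exact: (derivable_under_integral measurableT w_in i0 (fun w0 x _ _ => D0 w0 x)
    (fun x => normr_ge0 _) inorm ub).
rewrite -derive1E.
rewrite (differentiation_under_integral measurableT w_in i0 (fun w0 x _ _ => D0 w0 x)
    (fun x => normr_ge0 _) inorm ub).
by apply: eq_Rintegral => x _; rewrite D1.
Qed.

End Derivative.

Definition ft g (w : R) : R[i] := cosft g w +i* - sinft g w.

Lemma truncated_fourier_ft g : bounded_support g -> exists N : nat,
  forall n w, (N <= n)%N -> truncated_fourier (fun x => (g x)%:C) n w = ft g w.
Proof.
move=> bg; have ig := bounded_support_integrable bg.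
case: bg => mg [M [B gMB]].
exists (Num.truncn M).+1 => n w Nn.
have i0 : mu.-integrable setT (EFin \o (fun _ : R => 0 : R)) by exact: integrable0.
rewrite truncated_fourierE/=; [|exact: integrable_weighted|exact: integrable_weighted].
have -> : window (fun x => g x) n = g.
  apply/funext => x; rewrite /window patchE; case: ifPn => // /negP xN.
  apply/esym/(gMB x).2; rewrite ltNge; apply/negP => h; apply/xN/mem_set.
  rewrite /= in_itv/= -ler_norml (le_trans h)// (@le_trans _ _ (Num.truncn M).+1%:R)//.
    by rewrite ltW// truncnS_gt.
  by rewrite ler_nat.
have -> : window (fun _ => 0) n = (fun _ => 0 : R).
  by apply/funext => x; rewrite /window patchE; case: ifP.
have -> : cosft (fun _ => 0 : R) w = 0.
  by rewrite /cosft /Rintegral; under eq_integral do rewrite mul0r; rewrite integral0.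
have -> : sinft (fun _ => 0 : R) w = 0.
  by rewrite /sinft /Rintegral; under eq_integral do rewrite mul0r; rewrite integral0.
by rewrite addr0 sub0r.
Qed.

End CompactSupport.

(** * Framelets *)

Section Spline.
Context {R : realType}.
Local Notation mu := (@lebesgue_measure R).

Lemma is_derive_pow (f : R -> R) (n : nat) (x df : R) : is_derive x 1 f df ->
  is_derive x 1 (fun x => f x ^+ n) (n%:R * f x ^+ n.-1 * df).
Proof.
move=> dfx; have -> : (fun x => f x ^+ n) = f ^+ n.
  by apply/funext => z; elim: n => [|n IH]; rewrite ?expr0// !exprS IH.
by apply: is_derive_eq; rewrite /GRing.scale.
Qed.

Section ODE.
Variables (m k j : nat) (A : R) (Z : R -> R).
Hypothesis ZE : forall w, (w / 4) ^+ m * Z w = A * (cos (w / 4) ^+ k * sin (w / 4) ^+ j).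
Variables (w Z' : R).
Hypothesis dZ : is_derive w 1 Z Z'.

Local Notation t := (w / 4).

(* Differentiating ZE rather than Z avoids all quotients. *)
Let derivative_eq : 4 * t ^+ m * Z' + m%:R * t ^+ m.-1 * Z w =
  A * (j%:R * sin t ^+ j.-1 * cos t ^+ k.+1 - k%:R * cos t ^+ k.-1 * sin t ^+ j.+1).
Proof.
have d1 : is_derive w 1 (fun w => (w / 4) ^+ m * Z w)
    (t ^+ m * Z' + Z w * (m%:R * t ^+ m.-1 / 4)).
  have dp : is_derive w 1 (fun w => (w / 4) ^+ m) (m%:R * t ^+ m.-1 * 4^-1).
    by apply: is_derive_pow; apply: is_derive_eq; rewrite /GRing.scale/=; ring.
  by apply: is_derive_eq; rewrite /GRing.scale/=; ring.
have d2 : is_derive w 1 (fun w => A * (cos (w / 4) ^+ k * sin (w / 4) ^+ j))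
    (A * (j%:R * sin t ^+ j.-1 * cos t ^+ k.+1 - k%:R * cos t ^+ k.-1 * sin t ^+ j.+1) / 4).
  have dc : is_derive w 1 (fun w => cos (w / 4) ^+ k) (k%:R * cos t ^+ k.-1 * (- sin t / 4)).
    by apply: is_derive_pow; apply: is_derive_eq; rewrite /GRing.scale/=; field.
  have ds : is_derive w 1 (fun w => sin (w / 4) ^+ j) (j%:R * sin t ^+ j.-1 * (cos t / 4)).
    by apply: is_derive_pow; apply: is_derive_eq; rewrite /GRing.scale/=; field.
  by apply: is_derive_eq; rewrite /GRing.scale/= !exprS; field.
have E : (fun w => (w / 4) ^+ m * Z w) = (fun w => A * (cos (w / 4) ^+ k * sin (w / 4) ^+ j)).
  by apply/funext => w0; exact: ZE.
move: (@derive_val _ _ _ _ _ _ _ d1) (@derive_val _ _ _ _ _ _ _ d2).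
rewrite E => -> H; apply: (mulIf (lt0r_neq0 (@ltr0n R 4 : 0 < 4))).
by rewrite mulrC; apply/esym; move: H; rewrite [in X in X -> _]/= => H; lra.
Qed.

(** Also true at n = 0, where [n.-1] is 0, because the factor n vanishes; this covers k = 0. *)
Let pow_pred (x : R) (n : nat) : x * (n%:R * x ^+ n.-1) = n%:R * x ^+ n.
Proof. by case: n => [|n]; rewrite ?mul0r ?mulr0// exprS mulrCA. Qed.

(** [derivative_eq] is multiplied by t sin t cos t, which restores all lowered exponents; the
    hypothesis [ZE] then eliminates A cos^k sin^j. The constant [A] lets one equation serve both the
    cosine and the sine transform. *)
Lemma spline_ode : w != 0 ->
  4 * t * sin t * cos t * Z' =
  (t * (j%:R * cos t ^+ 2 - k%:R * sin t ^+ 2) - m%:R * sin t * cos t) * Z w.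
Proof.
move=> w0.
have t0 : t != 0 by rewrite mulf_neq0// invr_neq0.
apply: (mulfI (expf_neq0 m t0)).
have := pow_pred t m; have := pow_pred (sin t) j; have := pow_pred (cos t) k.
have := derivative_eq; have := ZE w; rewrite !exprS.
move: (t ^+ m) (t ^+ m.-1) (sin t ^+ j) (sin t ^+ j.-1) (cos t ^+ k) (cos t ^+ k.-1).
move: (Z w) (sin t) (cos t) => z s c; move: t => u tm tm1 sj sj1 ck ck1 e1 e2 e3 e4 e5.
transitivity (u * s * c * (4 * tm * Z' + m%:R * tm1 * z) - s * c * z * (u * (m%:R * tm1))).
  by ring.
rewrite e2 e5.
transitivity (u * A * (c * c * ck * (s * (j%:R * sj1)) - s * s * sj * (c * (k%:R * ck1)))
  - s * c * z * (m%:R * tm)); first by ring.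
rewrite e3 e4.
transitivity (u * (j%:R * c * c - k%:R * s * s) * (A * (ck * sj)) - s * c * z * (m%:R * tm)).
  by ring.
by rewrite -e1; ring.
Qed.

(** For k = 0 both sides of [spline_ode] carry a factor cos t, which cannot be cancelled at the
    zeros of the cosine; the elimination is therefore redone without multiplying by cos t. *)
Lemma spline_ode0 : w != 0 -> k = 0%N ->
  4 * t * sin t * Z' = (t * (j%:R * cos t) - m%:R * sin t) * Z w.
Proof.
move=> w0 k0.
have t0 : t != 0 by rewrite mulf_neq0// invr_neq0.
apply: (mulfI (expf_neq0 m t0)).
have := pow_pred t m; have := pow_pred (sin t) j.
have := derivative_eq; have := ZE w; rewrite k0 !exprS expr0.
move: (t ^+ m) (t ^+ m.-1) (sin t ^+ j) (sin t ^+ j.-1).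
move: (Z w) (sin t) (cos t) => z s c; move: t => u tm tm1 sj sj1 e1 e2 e4 e5.
transitivity (u * s * (4 * tm * Z' + m%:R * tm1 * z) - s * z * (u * (m%:R * tm1))).
  by ring.
rewrite e2 e5.
transitivity (u * c * A * (s * (j%:R * sj1)) - s * z * (m%:R * tm)); first by ring.
rewrite e4.
transitivity (u * c * j%:R * (A * (1 * sj)) - s * z * (m%:R * tm)); first by ring.
by rewrite -e1; ring.
Qed.

End ODE.

Definition profile (m l : nat) (w : R) : R :=
  Num.sqrt ('C(m, l)%:R) *
  (cos (w / 4) ^+ (m - l) * sin (w / 4) ^+ (m + l) / (w / 4) ^+ m).

Lemma mul_complexR (z : R[i]) (r : R) :
  z * r%:C = (complex.Re z * r) +i* (complex.Im z * r).
Proof. by case: z => a b; apply/eqP; rewrite eq_complex/= !mulr0 subr0 add0r !eqxx. Qed.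

Definition spline (m l : nat) (g : R -> R) : Prop :=
  bounded_support g /\ forall w, ft g w = framelet_hat m l w.

Lemma profile_eq m l w : (0 < m)%N -> (w / 4) ^+ m * profile m l w =
  Num.sqrt ('C(m, l)%:R) * (cos (w / 4) ^+ (m - l) * sin (w / 4) ^+ (m + l)).
Proof.
move=> m0; have [->|w0] := eqVneq w 0.
  (* At w = 0 both sides vanish: the left through 0^m, the right through sin 0, with positive
     exponents because m > 0. *)
  by rewrite mul0r expr0n sin0 expr0n addn_eq0 eqn0Ngt m0/= !mul0r mulr0 mulr0.
have t0 : (w / 4) ^+ m != 0 by rewrite expf_neq0// mulf_neq0// invr_neq0.
by rewrite /profile; field.
Qed.

Lemma profile0 m l : (0 < m)%N -> profile m l 0 = 0.
Proof.
move=> m0; rewrite /profile mul0r sin0 !expr0n addn_eq0 eqn0Ngt m0/=.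
by rewrite mulr0 mul0r mulr0.
Qed.

Lemma spline_components m l g w : spline m l g ->
  cosft g w = complex.Re ((0 +i* 1) ^+ l) * profile m l w /\
  sinft g w = - (complex.Im ((0 +i* 1) ^+ l) * profile m l w).
Proof.
move=> [_ /(_ w)]; rewrite /ft /framelet_hat -/(profile m l w) mul_complexR.
by move=> [-> <-]; rewrite opprK.
Qed.

End Spline.

(** * The two recursions on the Fourier side *)

Section Recursion.
Context {R : realType}.
Local Notation mu := (@lebesgue_measure R).

Section ShiftSum.
Variables u1 u2 u3 : R -> R.
Hypotheses (b1 : bounded_support u1) (b2 : bounded_support u2) (b3 : bounded_support u3).

(** The common shape of both recursions. The factors 1 make the body a literal instance of the
    linear combinations in [bounded_support_lin], [cosft_lin] and [sinft_lin]. *)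
Definition shift_sum (x : R) : R := 1 * (1 * u1 (x + 1 / 2) + 1 * u2 (x - 1 / 2)) + 1 * u3 x.

Let b12 : bounded_support (fun x => 1 * u1 (x + 1 / 2) + 1 * u2 (x - 1 / 2)).
Proof. by apply: bounded_support_lin; exact: bounded_support_shift. Qed.

Lemma bounded_support_shift_sum : bounded_support shift_sum.
Proof. exact: bounded_support_lin. Qed.

Lemma cosft_shift_sum w : cosft shift_sum w =
  cos (w / 2) * (cosft u1 w + cosft u2 w) +
  sin (w / 2) * (sinft u1 w - sinft u2 w) + cosft u3 w.
Proof.
rewrite /shift_sum cosft_lin; [|exact: bounded_support_integrable..].
rewrite cosft_lin; [|by apply: bounded_support_integrable; exact: bounded_support_shift..].
rewrite !cosft_translate; [|exact: bounded_support_integrable..].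
by rewrite mulrN sinN cosN !mulrA mulr1; ring.
Qed.

Lemma sinft_shift_sum w : sinft shift_sum w =
  cos (w / 2) * (sinft u1 w + sinft u2 w) -
  sin (w / 2) * (cosft u1 w - cosft u2 w) + sinft u3 w.
Proof.
rewrite /shift_sum sinft_lin; [|exact: bounded_support_integrable..].
rewrite sinft_lin; [|by apply: bounded_support_integrable; exact: bounded_support_shift..].
rewrite !sinft_translate; [|exact: bounded_support_integrable..].
by rewrite mulrN sinN cosN !mulrA mulr1; ring.
Qed.

End ShiftSum.

Lemma double_angle (w : R) :
  cos (w / 2) = cos (w / 4) ^+ 2 - sin (w / 4) ^+ 2 /\
  sin (w / 2) = 2 * sin (w / 4) * cos (w / 4).
Proof.
have -> : w / 2 = w / 4 + w / 4 by field.
by rewrite cosD sinD; split; ring.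
Qed.

Section Step.
Variables (m l : nat) (g : R -> R).
Hypotheses (m1 : (0 < m)%N) (sg : spline m l g).

Let bg : bounded_support g := sg.1.
Let bxg : bounded_support (fun x => x * g x).
Proof. exact: bounded_support_mulx. Qed.
Let ig := bounded_support_integrable bg.
Let ixg := bounded_support_integrable bxg.
Let m0 : m%:R != 0 :> R.
Proof. by rewrite pnatr_eq0 -lt0n. Qed.

Let p : R := complex.Re ((0 +i* 1) ^+ l : R[i]).
Let q : R := complex.Im ((0 +i* 1) ^+ l : R[i]).

Let cosE w : cosft g w = p * profile m l w := (spline_components w sg).1.
Let sinE w : sinft g w = - (q * profile m l w) := (spline_components w sg).2.

Let cosE' w : (w / 4) ^+ m * cosft g w =
  p * Num.sqrt ('C(m, l)%:R) * (cos (w / 4) ^+ (m - l) * sin (w / 4) ^+ (m + l)).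
Proof. by rewrite cosE mulrCA profile_eq//; ring. Qed.

Let sinE' w : (w / 4) ^+ m * sinft g w =
  - q * Num.sqrt ('C(m, l)%:R) * (cos (w / 4) ^+ (m - l) * sin (w / 4) ^+ (m + l)).
Proof. by rewrite sinE mulrN mulrCA profile_eq//; ring. Qed.

(** Each coefficient is affine in the shifted variable, for instance (2x + m + 1) / (2m) = (x + 1/2)
    / m + 1/2, so each term of a recursion is a shift of some [u a b]. *)
Let u (a b : R) (x : R) : R := a * (x * g x) + b * g x.

Let bu a b : bounded_support (u a b).
Proof. exact: (bounded_support_lin a b bxg bg). Qed.

Let cosu a b w : cosft (u a b) w = a * cosft (fun x => x * g x) w + b * cosft g w.
Proof. exact: (cosft_lin a b w ixg ig). Qed.

Let sinu a b w : sinft (u a b) w = a * sinft (fun x => x * g x) w + b * sinft g w.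
Proof. exact: (sinft_lin a b w ixg ig). Qed.

Definition step (x : R) : R :=
  Num.sqrt (m.+1%:R / (m.+1%:R - l%:R)) *
  ((2 * x + m%:R + 1) / (2 * m%:R) * g (x + 1 / 2) +
   (m%:R + 1 - 2 * x) / (2 * m%:R) * g (x - 1 / 2) + l%:R / m%:R * g x).

Definition step_top (x : R) : R :=
  (2 * x + m%:R + 1) / (2 * m%:R) * g (x + 1 / 2) +
  (2 * x - m%:R - 1) / (2 * m%:R) * g (x - 1 / 2) - (2 * x) / m%:R * g x.

Let K : R := Num.sqrt (m.+1%:R / (m.+1%:R - l%:R)).

Let stepE : step =
  shift_sum (u (K / m%:R) (K / 2)) (u (- K / m%:R) (K / 2)) (u 0 (K * (l%:R / m%:R))).
Proof. by apply/funext => x; rewrite /step /shift_sum /u -/K; field. Qed.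

Let step_topE : step_top =
  shift_sum (u (m%:R^-1) 2^-1) (u (m%:R^-1) (- 2^-1)) (u (- 2 / m%:R) 0).
Proof. by apply/funext => x; rewrite /step_top /shift_sum /u; field. Qed.

Let key_step (w Z Z' : R) : (l <= m)%N -> w != 0 ->
  4 * (w / 4) * sin (w / 4) * cos (w / 4) * Z' =
  (w / 4 * ((m + l)%:R * cos (w / 4) ^+ 2 - (m - l)%:R * sin (w / 4) ^+ 2) -
   m%:R * sin (w / 4) * cos (w / 4)) * Z ->
  cos (w / 2) * (K * Z) - sin (w / 2) * (2 * K / m%:R * Z') + K * (l%:R / m%:R) * Z =
  K * (sin (w / 4) * cos (w / 4) / (w / 4)) * Z.
Proof.
move=> lm w0; have [-> ->] := double_angle w.
have t0 : w / 4 != 0 by rewrite mulf_neq0// invr_neq0.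
rewrite natrD natrB//.
have cs := cos2Dsin2 (w / 4).
move: (sin _) (cos _) cs => s c cs; move: (w / 4) t0 => t t0.
move: (m%:R) m0 (l%:R) => M M0 L e; apply: (mulfI t0).
(* Writing L / M as L / M (c^2 + s^2) produces the coefficients m + l and m - l of the differential
   equation. *)
transitivity (K * (t * (c ^+ 2 - s ^+ 2 + L / M * (c ^+ 2 + s ^+ 2)) * Z -
                   (4 * t * s * c * Z') / M)); first by rewrite cs; field.
by rewrite e; field; rewrite t0 M0.
Qed.

(** Here Z' is multiplied by cos(w/2) - 1 = -2 sin^2(w/4), which supplies sines but no cosine; hence
    the equation free of the factor cos(w/4). *)
Let key_top (w Z Z' : R) : l = m -> w != 0 ->
  4 * (w / 4) * sin (w / 4) * Z' =
  (w / 4 * ((m + l)%:R * cos (w / 4)) - m%:R * sin (w / 4)) * Z ->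
  sin (w / 2) * Z + 2 / m%:R * (cos (w / 2) - 1) * Z' =
  sin (w / 4) ^+ 2 / (w / 4) * Z.
Proof.
move=> lm w0; have [-> ->] := double_angle w; rewrite lm natrD.
have t0 : w / 4 != 0 by rewrite mulf_neq0// invr_neq0.
rewrite [cos _ ^+ 2]cos2sin2.
move: (sin _) (cos _) => s c; move: (w / 4) t0 => t t0.
move: (m%:R) m0 => M M0 e; apply: (mulfI t0).
transitivity (2 * t * s * c * Z - s * (4 * t * s * Z') / M); first by field.
by rewrite e; field; rewrite t0 M0.
Qed.

Let dcos (w : R) : is_derive w 1 (cosft g) (- sinft (fun x => x * g x) w).
Proof. exact: is_derive_cosft. Qed.

Let dsin (w : R) : is_derive w 1 (sinft g) (cosft (fun x => x * g x) w).
Proof. exact: is_derive_sinft. Qed.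

(** Origin of the square root in the first recursion: (m + 1 - l) C(m+1, l) = (m + 1) C(m, l). *)
Lemma sqrt_bin_step : (l <= m)%N ->
  K * Num.sqrt ('C(m, l)%:R) = Num.sqrt ('C(m.+1, l)%:R).
Proof.
move=> lm; rewrite /K -natrB; last exact: leqW.
have d0 : (m.+1 - l)%:R != 0 :> R by rewrite pnatr_eq0 -lt0n subn_gt0 ltnS.
rewrite -sqrtrM ?divr_ge0//; congr Num.sqrt.
by rewrite mulrAC -natrM mul_bin_down natrM mulrC mulKf.
Qed.

Lemma profile_step (w : R) : (l <= m)%N -> w != 0 ->
  profile m.+1 l w = K * (sin (w / 4) * cos (w / 4) / (w / 4)) * profile m l w.
Proof.
move=> lm w0; rewrite /profile -sqrt_bin_step// subSn// addSn !exprS.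
have t0 : w / 4 != 0 by rewrite mulf_neq0// invr_neq0.
move: (w / 4) t0 => t t0; have tm0 := expf_neq0 m t0.
by field; rewrite ?tm0 ?t0.
Qed.

Lemma profile_step_top (w : R) : l = m -> w != 0 ->
  profile m.+1 m.+1 w = sin (w / 4) ^+ 2 / (w / 4) * profile m l w.
Proof.
move=> -> w0; rewrite /profile !subnn !binn addSn addnS !exprS expr0.
have t0 : w / 4 != 0 by rewrite mulf_neq0// invr_neq0.
move: (w / 4) t0 => t t0; have tm0 := expf_neq0 m t0.
by field; rewrite ?tm0 ?t0.
Qed.

Lemma spline_step : (l <= m)%N -> spline m.+1 l step.
Proof.
move=> lm; split; first by rewrite stepE; exact: bounded_support_shift_sum.
move=> w; rewrite /ft /framelet_hat -/(profile m.+1 l w) mul_complexR -/p -/q.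
rewrite stepE cosft_shift_sum// sinft_shift_sum// !cosu !sinu.
(* The differential equation is available only for nonzero w. At w = 0 the two terms in x g(x)
   cancel, and the transform of g vanishes. *)
have [->|w0] := eqVneq w 0.
  by rewrite !mul0r sin0 cos0 cosE sinE !profile0//; congr (_ +i* _); ring.
have := key_step lm w0 (spline_ode cosE' (dcos w) w0).
have := key_step lm w0 (spline_ode sinE' (dsin w) w0).
rewrite cosE sinE (profile_step lm w0) => eS eC.
congr (_ +i* _).
  transitivity (K * (sin (w / 4) * cos (w / 4) / (w / 4)) * (p * profile m l w)); last by ring.
  by rewrite -eC; field.
transitivity (- (K * (sin (w / 4) * cos (w / 4) / (w / 4)) * - (q * profile m l w))); last by ring.
by rewrite -eS; field.
Qed.

Lemma spline_step_top : l = m -> spline m.+1 m.+1 step_top.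
Proof.
move=> lm; split; first by rewrite step_topE; exact: bounded_support_shift_sum.
move=> w; rewrite /ft /framelet_hat -/(profile m.+1 m.+1 w) mul_complexR.
(* Raising the second index multiplies p + iq by i, giving -q + ip: the new cosine transform comes
   from the old sine transform and conversely. *)
have -> : complex.Re ((0 +i* 1) ^+ m.+1 : R[i]) = - q.
  by rewrite exprS -lm /q; case: (_ ^+ l) => a b /=; ring.
have -> : complex.Im ((0 +i* 1) ^+ m.+1 : R[i]) = p.
  by rewrite exprS -lm /p; case: (_ ^+ l) => a b /=; ring.
rewrite step_topE cosft_shift_sum// sinft_shift_sum// !cosu !sinu.
have [->|w0] := eqVneq w 0.
  by rewrite !mul0r sin0 cos0 cosE sinE !profile0//; congr (_ +i* _); field.
have ml : (m - l = 0)%N by rewrite lm subnn.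
have := key_top lm w0 (spline_ode0 cosE' (dcos w) w0 ml).
have := key_top lm w0 (spline_ode0 sinE' (dsin w) w0 ml).
rewrite cosE sinE (profile_step_top lm w0) => eS eC.
congr (_ +i* _).
  transitivity (sin (w / 4) ^+ 2 / (w / 4) * - (q * profile m l w)); last by ring.
  by rewrite -eS; field.
transitivity (sin (w / 4) ^+ 2 / (w / 4) * (p * profile m l w)); last by ring.
by rewrite -eC; field.
Qed.

End Step.
End Recursion.

(** * Existence of compactly supported representatives *)

Section Existence.
Context {R : realType}.
Local Notation mu := (@lebesgue_measure R).

Definition box : R -> R := \1_`[- (1 / 4), 1 / 4].

Lemma bounded_support_box : bounded_support box.
Proof.
split; first exact: measurable_indic.
exists (1 / 4), 1 => x; rewrite /box indicE; split.
  by case: (x \in _); rewrite ?normr1 ?normr0.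
move=> x4; have [/set_mem|//] := boolP (x \in `[- (1 / 4), 1 / 4]%classic).
by rewrite /= in_itv/= -ler_norml leNgt x4.
Qed.

Let ibox := bounded_support_integrable bounded_support_box.

Lemma sinft_box (w : R) : sinft box w = 0.
Proof.
apply: Rintegral_odd; first exact: integrable_mul_sin.
move=> x; rewrite mulrN sinN mulrN; congr (- (_ * _)).
rewrite /box !indicE; congr (_ : bool)%:R.
apply/idP/idP => /set_mem; rewrite /= !in_itv/= => H; apply/mem_set; rewrite /= in_itv/=; lra.
Qed.

Lemma cosft_box (w : R) : w != 0 -> cosft box w = 2 * sin (w / 4) / w.
Proof.
move=> w0.
have dF (x : R) : is_derive x 1 (fun x => sin (w * x) / w) (cos (w * x)).
  by apply: is_derive_eq; rewrite /GRing.scale/=; field.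
have cF : continuous (fun x : R => sin (w * x) / w).
  move=> x; apply/differentiable_continuous/derivable1_diffP.
  exact: (@ex_derive _ _ _ _ _ _ _ (dF x)).
rewrite /cosft; transitivity (\int[mu]_(x in `[- (1 / 4), 1 / 4]) cos (w * x)).
  rewrite [RHS]Rintegral_mkcond; apply: eq_Rintegral => x _.
  by rewrite patchE /box indicE; case: (x \in _); rewrite ?mul1r ?mul0r.
rewrite /Rintegral (@continuous_FTC2 _ _ (fun x => sin (w * x) / w)).
- rewrite -EFinB /= mulrN sinN mulrA mulr1; field; exact: w0.
- lra.
- apply: continuous_subspaceT => x.
  apply: (@continuous_comp _ _ _ (fun x => w * x) cos); last exact: continuous_cos.
  exact: mulrl_continuous.
- split.
  + by move=> x _; exact: (@ex_derive _ _ _ _ _ _ _ (dF x)).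
  + by apply: cvg_at_right_filter; exact: cF.
  + by apply: cvg_at_left_filter; exact: cF.
- by move=> x _; rewrite derive1E (@derive_val _ _ _ _ _ _ _ (dF x)).
Qed.

(** The box has transform 2 sin(w/4) / w and the difference of shifts contributes 2i sin(w/4); the
    product is i sin^2(w/4) / (w/4). The two closed boxes overlap only at 0. *)
Definition haar (x : R) : R := 1 * box (x + 1 / 4) + -1 * box (x - 1 / 4).

Lemma spline_haar : spline 1 1 haar.
Proof.
have bs a : bounded_support (fun x => box (x + a)).
  exact: bounded_support_shift bounded_support_box.
split; first exact: bounded_support_lin.
move=> w; rewrite /ft /haar cosft_lin ?sinft_lin; try exact: bounded_support_integrable.
rewrite !cosft_translate// !sinft_translate// sinft_box mulrN cosN sinN mulrA mulr1.
rewrite /framelet_hat -/(profile 1 1 w) mul_complexR expr1 /= /profile subnn binn sqrtr1.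
rewrite ?expr0 !mul1r; congr (_ +i* _); first by ring.
have [->|w0] := eqVneq w 0; first by rewrite mul0r sin0 !expr0n/=; ring.
by rewrite cosft_box// expr1; field.
Qed.

(** The pair (m, l) is reached along the diagonal from (1, 1) to (l, l) by [step_top], then with l
    fixed by [step]. *)
Lemma spline_exists m l : (1 <= l <= m)%N -> exists g : R -> R, spline m l g.
Proof.
move=> /andP[l1 lm].
have top : exists g : R -> R, spline l l g.
  case: l l1 {lm} => // l _; elim: l => [|l [g sg]]; first by exists haar; exact: spline_haar.
  by exists (step_top l.+1 g); exact: spline_step_top sg erefl.
rewrite -(subnK lm); elim: (m - l)%N => [|d [g sg]]; first by rewrite add0n.
exists (step (d + l) l g); rewrite addSn; apply: spline_step sg _; last exact: leq_addl.
by rewrite (leq_trans l1)// leq_addl.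
Qed.

Lemma framelet_ae m l (g : R -> R) (psi : R -> R[i]) :
  spline m l g -> is_framelet m l psi -> {ae mu, forall x, psi x = (g x)%:C}.
Proof.
move=> [bg gE] fpsi; have [N HN] := truncated_fourier_ft bg.
apply: (fourier_transform_unique fpsi (N := N)) => /=.
- exact/integrable_weighted/bounded_support_integrable.
- apply: integrable_weighted; exact: integrable0.
- by move=> n w Nn; rewrite HN.
Qed.

End Existence.

Theorem theorem1 (R : realType) (m : nat) (hm : (1 <= m)%N) :
  (forall (l : nat) (psi psi' : R -> R[i]), (1 <= l <= m)%N ->
     is_framelet m l psi -> is_framelet m.+1 l psi' ->
     {ae lebesgue_measure, forall x : R,
       psi' x =
       (Num.sqrt (m.+1%:R / (m.+1%:R - l%:R)))%:C *
       (((2 * x + m%:R + 1) / (2 * m%:R))%:C * psi (x + 1 / 2)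
        + ((m%:R + 1 - 2 * x) / (2 * m%:R))%:C * psi (x - 1 / 2)
        + (l%:R / m%:R)%:C * psi x)})
  /\
  (forall (psi psi' : R -> R[i]),
     is_framelet m m psi -> is_framelet m.+1 m.+1 psi' ->
     {ae lebesgue_measure, forall x : R,
       psi' x =
       ((2 * x + m%:R + 1) / (2 * m%:R))%:C * psi (x + 1 / 2)
       + ((2 * x - m%:R - 1) / (2 * m%:R))%:C * psi (x - 1 / 2)
       - ((2 * x) / m%:R)%:C * psi x}).
Proof.
have aeF := ae_filter_ringOfSetsType (@lebesgue_measure R).
split=> [l psi psi' lm|psi psi'] fpsi fpsi'.
  have [g sg] := @spline_exists R _ _ lm.
  have [_ lem] := andP lm.
  have psiE := framelet_ae sg fpsi.
  have psi'E := framelet_ae (spline_step hm sg lem) fpsi'.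
  (* Off four null sets every framelet value is a value of g or of [step], and the identity becomes
     the definition of [step] embedded in the complex numbers. *)
  apply: (filterS2 aeF _ psi'E (filterI psiE
    (filterI (ae_shift (1 / 2) psiE) (ae_shift (- (1 / 2)) psiE)))).
  move=> x /= -> [-> [-> ->]].
  by rewrite /step !(rmorphD, rmorphM).
have [g sg] : exists g : R -> R, spline m m g by apply: spline_exists; rewrite hm leqnn.
have psiE := framelet_ae sg fpsi.
have psi'E := framelet_ae (spline_step_top hm sg erefl) fpsi'.
apply: (filterS2 aeF _ psi'E (filterI psiE
  (filterI (ae_shift (1 / 2) psiE) (ae_shift (- (1 / 2)) psiE)))).
move=> x /= -> [-> [-> ->]].
by rewrite /step_top !(rmorphD, rmorphM, rmorphN, rmorphB).
Qed.
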